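(* Let $\Gamma$ be a group such that $\mathbb Z[\Gamma]$ is Noetherian and let $G$ be a dimension $\Gamma$-group which satisfies (SDP$_{\Delta_0}$) for some subgroup $\Delta_0\subseteq\mathrm{Stab}(G)$. Let $\Delta$ be the normal closure of $\Delta_0$ in $\Gamma$. (1) There are a directed set $I$, simplicial $\Gamma$-groups $G_i$, $i\in I$, with simplicial $\Gamma$-bases stabilized by $\Delta$, a directed system $(G_i,g_{ij})$ of $\mathbf{OG}_\Gamma$, and an isomorphism between $G$ and a direct limit of $(G_i,g_{ij})$ in $\mathbf{OG}_\Gamma$. (2) If $(G,u)$ is an object of $\mathbf{OG}^u_\Gamma$, the directed system and the isomorphism from (1) can be found in $\mathbf{OG}^u_\Gamma$. (3) If $(G,D)$ is an object of $\mathbf{OG}^D_\Gamma$, the directed system and the isomorphism from (1) can be found in $\mathbf{OG}^D_\Gamma$. If $G$ is considered to be a $\Gamma$-$\mathbb Z_2$-bigroup with the trivial $\mathbb Z_2$-action, the directed systems and isomorphisms in the three parts can be found in the categories $\mathbf{OG}^*_\Gamma$, $\mathbf{OG}^{u*}_\Gamma$, and $\mathbf{OG}^{D*}_\Gamma$ respectively.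
   Context: Ordered groups. $\mathbb Z^+[\Gamma]\subseteq\mathbb Z[\Gamma]$ is the set of elements with all coefficients nonnegative. An ordered $\Gamma$-group is a left $\mathbb Z[\Gamma]$-module $G$ with a partial order such that $g_1\ge g_2$ implies $g_1+h\ge g_2+h$ and $\gamma g_1\ge\gamma g_2$ for $\gamma\in\Gamma$; $G^+=\{x\ge0\}$. $G$ is directed if any two elements have a common upper bound. $\mathrm{Stab}(G)=\{\gamma\in\Gamma:\gamma x=x\text{ for all }x\in G\}$. An order-unit is $u\in G^+$ such that for every $x\in G$ there is a nonzero $a\in\mathbb Z^+[\Gamma]$ with $x\le au$. A generating interval is a subset $D\subseteq G^+$ containing $0$ which is upwards directed, convex ($x\le z\le y$, $x,y\in D$ implies $z\in D$), and such that every element of $G^+$ is a finite sum of elements $ad$, $a\in\mathbb Z^+[\Gamma]$, $d\in D$. $\mathbf{OG}_\Gamma$: ordered $\Gamma$-groups with order-preserving ($f(G^+)\subseteq H^+$) $\mathbb Z[\Gamma]$-homomorphisms. $\mathbf{OG}^u_\Gamma$: pairs $(G,u)$, $u$ an order-unit, with morphisms of $\mathbf{OG}_\Gamma$ taking order-unit to order-unit. $\mathbf{OG}^D_\Gamma$: pairs $(G,D)$, $D$ a generating interval, with morphisms $f:(G,D)\to(H,E)$ of $\mathbf{OG}_\Gamma$ with $f(D)\subseteq E$. The versions with $*$ ($\mathbf{OG}^*_\Gamma,\mathbf{OG}^{u*}_\Gamma,\mathbf{OG}^{D*}_\Gamma$) have objects with an additional $\mathbb Z_2$-action $x\mapsto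 x^*$ by additive order-preserving maps commuting with $\Gamma$ (a $\Gamma$-$\mathbb Z_2$-bigroup), with $u^*=u$, $D^*=D$ where relevant, and morphisms commuting with $*$. Simplicial $\Gamma$-groups. For a subgroup $\Delta$ of $\Gamma$, $\mathbb Z[\Gamma/\Delta]$ is the permutation module on left cosets with cone $\mathbb Z^+[\Gamma/\Delta]$ and $\pi:\mathbb Z[\Gamma]\to\mathbb Z[\Gamma/\Delta]$ is the left module map $1\mapsto\Delta$. A finite set $X=\{x_1,\dots,x_n\}$ in a $\Gamma$-group (left $\mathbb Z[\Gamma]$-module) $G$ is a simplicial $\Gamma$-basis stabilized by $\Delta$ if each $x_i$ has stabilizer $\Delta$ and, for all $a_i,b_i\in\mathbb Z[\Gamma]$ with $\pi(a_i),\pi(b_i)\in\mathbb Z^+[\Gamma/\Delta]$, $\sum a_ix_i=\sum b_ix_i$ iff $a_i-b_i\in\ker\pi$ for all $i$; its cone is $\{\sum a_ix_i:\pi(a_i)\in\mathbb Z^+[\Gamma/\Delta]\}$. A simplicial $\Gamma$-group is a $\Gamma$-group ordered by, and directed under, the cone of such a finite simplicial $\Gamma$-basis, or the zero group (with basis $\varnothing$, which counts as stabilized by any subgroup). Dimension $\Gamma$-groups. (SDP$_\Delta$) for a directed ordered $\Gamma$-group $G$: if $\sum_{i=1}^n a_ix_i=0$ for some $a_i\in\mathbb Z[\Gamma]$ and $x_i\in G^+$, then there are a positive integer $m$, $b_{ij}\in\mathbb Z^+[\Gamma]$ and $y_j\in G^+$ such that $x_i=\sum_{j=1}^m b_{ij}y_j$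 for all $i$ and $\sum_{i=1}^n\pi(a_ib_{ij})=0$ for all $j=1,\dots,m$. A dimension $\Gamma$-group is a directed ordered $\Gamma$-group satisfying (SDP$_\Delta$) for some subgroup $\Delta\subseteq\mathrm{Stab}(G)$. *)

(* Defs.v *)
From HB Require Import structures.
From mathcomp Require Import all_boot all_order all_algebra.
From mathcomp Require Import finmap monalg.
From mathcomp Require Import boolp classical_sets.

Set Implicit Arguments.
Unset Strict Implicit.
Unset Printing Implicit Defensive.

Import Order.TTheory GRing.Theory Num.Theory.

Local Open Scope classical_set_scope.
Local Open Scope ring_scope.


Section LinearExtension.
Context (K : choiceType) (V : zmodType).
Implicit Types (f g : K -> V) (x y : {malg int[K]}).

Definition zlin f x : V := \sum_(k <- msupp x) f k *~ x@_k.

Lemma zlinEw f x (d : {fset K}) : (msupp x `<=` d)%fset ->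
  zlin f x = \sum_(k <- d) f k *~ x@_k.
Proof.
move=> le_xd; rewrite /zlin (big_fset_incl _ le_xd) // => k _.
by rewrite -mcoeff_eq0 => /eqP ->; rewrite mulr0z.
Qed.

Lemma zlin_is_additive f : zmod_morphism (zlin f).
Proof.
move=> x y; pose d := (msupp x `|` msupp y)%fset.
rewrite (@zlinEw f (x - y) d) ?msuppB_le //.
rewrite (@zlinEw f x d) ?fsubsetUl // (@zlinEw f y d) ?fsubsetUr //.
rewrite -sumrB; apply: eq_bigr => k _.
by rewrite mcoeffB mulrzBr.
Qed.

HB.instance Definition _ f :=
  GRing.isZmodMorphism.Build {malg int[K]} V (zlin f) (zlin_is_additive f).

Lemma zlinU f c k : zlin f << c *g k >> = f k *~ c.
Proof.
rewrite (@zlinEw f _ [fset k]%fset) ?msuppU_le //.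
by rewrite big_seq_fset1 mcoeffUU.
Qed.

Lemma zlinDf f g x : zlin (fun k => f k + g k) x = zlin f x + zlin g x.
Proof.
by rewrite /zlin -big_split; apply: eq_bigr => k _; rewrite mulrzDl.
Qed.

Lemma malg_ext (f g : {additive {malg int[K]} -> V}) :
  (forall k, f << k >> = g << k >>) -> f =1 g.
Proof.
have E (h : {additive {malg int[K]} -> V}) k (c : int) :
  h << c *g k >> = h << k >> *~ c.
  by rewrite -(raddfMz h) -(raddfMz (mkmalgU k)) intz.
move=> fg x; rewrite [x]monalgE (raddf_sum f) (raddf_sum g).
by apply: eq_bigr => k _; rewrite (E f) (E g) fg.
Qed.

End LinearExtension.

(* monalg puts a ring structure on {malg int[K]} only for monomType, which
   excludes nontrivial groups; the product is therefore defined below. *)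
Definition group_ring (Γ : groupType) : Type := {malg int[Γ]}.
HB.instance Definition _ (Γ : groupType) := GRing.Zmodule.on (group_ring Γ).

Definition gelt (Γ : groupType) (γ : Γ) : group_ring Γ := << γ >>.

(* The Z-bilinear extension of a map Γ x K -> K. It gives both the product
   of Z[Γ] and the module structure of a permutation module. *)
Definition zact (Γ : groupType) (K : choiceType) (act : Γ -> K -> K)
    (a : group_ring Γ) (x : {malg int[K]}) : {malg int[K]} :=
  zlin (fun γ => zlin (fun k => << act γ k >>) x) a.

Section ZactTheory.
Context (Γ : groupType) (K : choiceType) (act : Γ -> K -> K).
Implicit Types (a b : group_ring Γ) (x y : {malg int[K]}) (γ : Γ) (k : K).
Local Notation "a ∗ x" := (zact act a x) (at level 40).

Lemma zact_is_additive_r a : zmod_morphism (zact act a).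
Proof.
move=> x y; apply/esym/(canLR (addrK _))/esym.
rewrite /zact -zlinDf; congr (zlin _ a); apply/funext => γ.
by rewrite -raddfD subrK.
Qed.
HB.instance Definition _ a := GRing.isZmodMorphism.Build
  {malg int[K]} {malg int[K]} (zact act a) (zact_is_additive_r a).

Lemma zact_is_additive_l x : zmod_morphism (fun a => a ∗ x).
Proof. by move=> a b; rewrite /zact raddfB. Qed.

Lemma zactBr a x y : a ∗ (x - y) = a ∗ x - a ∗ y.
Proof. exact: raddfB. Qed.
Lemma zactDr a x y : a ∗ (x + y) = a ∗ x + a ∗ y.
Proof. exact: raddfD. Qed.
Lemma zactBl x a b : (a - b) ∗ x = a ∗ x - b ∗ x.
Proof. exact: zact_is_additive_l. Qed.
Lemma zactDl x a b : (a + b) ∗ x = a ∗ x + b ∗ x.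
Proof. by rewrite /zact raddfD. Qed.
Lemma zactUU γ k : gelt γ ∗ << k >> = << act γ k >>.
Proof. by rewrite /zact /gelt !zlinU !mulr1z. Qed.

End ZactTheory.

Lemma zactA (Γ : groupType) (K : choiceType) (act : Γ -> K -> K) :
    (forall γ δ k, act γ (act δ k) = act (γ * δ)%g k) ->
  forall (a b : group_ring Γ) x,
    zact act a (zact act b x) =
    zact act (zact (fun γ δ => (γ * δ)%g) a b) x.
Proof.
move=> actM a b x.
pose mk (V : zmodType) (L : choiceType) (f : {malg int[L]} -> V)
  (fB : zmod_morphism f) : {additive {malg int[L]} -> V} :=
  HB.pack f (GRing.isZmodMorphism.Build _ _ f fB).
have B1 : zmod_morphism (fun a : {malg int[Γ]} => zact act a (zact act b x)).
  by move=> u v; rewrite zactBl.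
have B2 : zmod_morphism (fun a : {malg int[Γ]} =>
    zact act (zact (fun γ δ => (γ * δ)%g) a b) x).
  by move=> u v; rewrite zactBl zactBl.
apply: (@malg_ext _ _ (mk _ _ _ B1) (mk _ _ _ B2)) => γ /= {a B1 B2}.
have B1 : zmod_morphism (fun b : {malg int[Γ]} =>
    zact act << γ >> (zact act b x)).
  by move=> u v; rewrite zactBl zactBr.
have B2 : zmod_morphism (fun b : {malg int[Γ]} =>
    zact act (zact (fun γ δ => (γ * δ)%g) << γ >> b) x).
  by move=> u v; rewrite zactBr zactBl.
apply: (@malg_ext _ _ (mk _ _ _ B1) (mk _ _ _ B2)) => δ /= {b B1 B2}.
have B1 : zmod_morphism (fun x : {malg int[K]} =>
    zact act << γ >> (zact act << δ >> x)).
  by move=> u v; rewrite !zactBr.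
have B2 : zmod_morphism (fun x : {malg int[K]} =>
    zact act (zact (fun γ δ => (γ * δ)%g) << γ >> << δ >>) x).
  by move=> u v; rewrite zactBr.
apply: (@malg_ext _ _ (mk _ _ _ B1) (mk _ _ _ B2)) => k /= {x B1 B2}.
by rewrite !zactUU actM.
Qed.

Lemma zact1 (Γ : groupType) (K : choiceType) (act : Γ -> K -> K) :
  (forall k, act 1%g k = k) -> left_id (gelt 1%g) (zact act).
Proof.
move=> act1; have B2 : zmod_morphism (fun x : {malg int[K]} => x) by [].
pose g : {additive {malg int[K]} -> {malg int[K]}} :=
  HB.pack (fun x : {malg int[K]} => x) (GRing.isZmodMorphism.Build _ _ _ B2).
apply: (@malg_ext _ _ (zact act (gelt 1%g)) g) => k /=.
by rewrite zactUU act1.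
Qed.

Section GroupRing.
Context (Γ : groupType).

Definition gmul : group_ring Γ -> group_ring Γ -> group_ring Γ :=
  zact (fun γ δ => (γ * δ)%g).

Let gmulA : associative gmul.
Proof. by move=> a b c; apply: zactA => γ δ ε; rewrite mulgA. Qed.

Let gmul1 : right_id (gelt 1%g) gmul.
Proof.
have B1 : zmod_morphism (fun a => gmul a (gelt 1%g)).
  exact: zact_is_additive_l.
have B2 : zmod_morphism (fun x : {malg int[Γ]} => x) by [].
pose f : {additive {malg int[Γ]} -> {malg int[Γ]}} :=
  HB.pack (fun a => gmul a (gelt 1%g)) (GRing.isZmodMorphism.Build _ _ _ B1).
pose g : {additive {malg int[Γ]} -> {malg int[Γ]}} :=
  HB.pack (fun x : {malg int[Γ]} => x) (GRing.isZmodMorphism.Build _ _ _ B2).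
by apply: (@malg_ext _ _ f g) => γ /=; rewrite /gmul zactUU mulg1.
Qed.

Let gelt1_neq0 : gelt 1%g != 0 :> group_ring Γ.
Proof. by rewrite monalgU_eq0 oner_eq0. Qed.

HB.instance Definition _ := GRing.Zmodule_isNzRing.Build (group_ring Γ)
  gmulA (zact1 (@mul1g Γ)) gmul1
  (fun a b c => zactDl _ c a b) (fun a b c => zactDr _ a b c) gelt1_neq0.

Lemma geltM (γ δ : Γ) : gelt (γ * δ)%g = gelt γ * gelt δ.
Proof. by rewrite [RHS]zactUU. Qed.

Lemma gelt1 : gelt 1%g = 1 :> group_ring Γ.
Proof. by []. Qed.

End GroupRing.

Definition malg_ge0 (K : choiceType) : set {malg int[K]} :=
  [set x | forall k, 0 <= x@_k].
Arguments malg_ge0 : clear implicits.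

Definition left_ideal (R : pzRingType) (J : set R) :=
  [/\ J 0, forall x y, J x -> J y -> J (x + y) & forall a x, J x -> J (a * x)].

Definition left_noetherian (R : pzRingType) := forall J : set R, left_ideal J ->
  exists (n : nat) (x : 'I_n -> R),
    J = [set y | exists a : 'I_n -> R, y = \sum_i a i * x i].

(* Two-sided notion: the left ideals of the converse ring R^c are the right
   ideals of R. *)
Definition noetherian (R : pzRingType) :=
  left_noetherian R /\ left_noetherian R^c.

Definition subgroup (Γ : groupType) (Δ : set Γ) :=
  Δ 1%g /\ forall γ δ, Δ γ -> Δ δ -> Δ (γ / δ)%g.

Definition normal_subgroup (Γ : groupType) (Δ : set Γ) :=
  subgroup Δ /\ forall γ δ, Δ δ -> Δ (δ ^ γ)%g.

Definition normal_closure (Γ : groupType) (Δ : set Γ) : set Γ :=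
  \bigcap_(N in [set N | normal_subgroup N /\ Δ `<=` N]) N.

Section Cosets.
Context (Γ : groupType) (Δ : set Γ).

Definition lcoset (γ : Γ) : set Γ := [set (γ * δ)%g | δ in Δ].

Record coset := Coset { coset_set : set Γ; _ : coset_set \in range lcoset }.

HB.instance Definition _ := [isSub for coset_set].
HB.instance Definition _ := [Choice of coset by <:].

Lemma lcoset_subproof γ : lcoset γ \in range lcoset.
Proof. by apply/mem_set; exists γ. Qed.
Definition coset_of (γ : Γ) : coset := Coset (lcoset_subproof γ).

Lemma lcosetM γ δ : [set (γ * x)%g | x in lcoset δ] = lcoset (γ * δ)%g.
Proof.
rewrite /lcoset image_comp; apply: eq_imagel => x _.
by rewrite /= mulgA.
Qed.

Lemma coset_act_subproof γ (C : coset) :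
  [set (γ * x)%g | x in coset_set C] \in range lcoset.
Proof.
case: C => C /= /set_mem [δ _ <-]; apply/mem_set.
by exists (γ * δ)%g => //; rewrite lcosetM.
Qed.
Definition coset_act γ (C : coset) : coset := Coset (coset_act_subproof γ C).

Lemma coset_actE γ δ : coset_act γ (coset_of δ) = coset_of (γ * δ)%g.
Proof. by apply/val_inj => /=; rewrite lcosetM. Qed.

Lemma coset_actM γ δ C : coset_act γ (coset_act δ C) = coset_act (γ * δ)%g C.
Proof.
apply/val_inj; rewrite /= image_comp; apply: eq_imagel => x _.
by rewrite /= mulgA.
Qed.

Lemma coset_act1 C : coset_act 1%g C = C.
Proof.
apply/val_inj; rewrite /= -[RHS]image_id; apply: eq_imagel => x _.
by rewrite mul1g.
Qed.

Definition perm_module : Type := {malg int[coset]}.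
HB.instance Definition _ := GRing.Zmodule.on perm_module.
HB.instance Definition _ :=
  GRing.Zmodule_isLmodule.Build (group_ring Γ) perm_module
  (@zactA _ _ coset_act coset_actM) (zact1 coset_act1)
  (fun a x y => zactDr _ a x y) (fun x a b => zactDl _ x a b).

(* The left module map Z[Γ] -> Z[Γ/Δ] sending 1 to the coset Δ. *)
Definition coset_proj (a : group_ring Γ) : perm_module :=
  a *: (<< coset_of 1%g >> : perm_module).

Lemma coset_projU γ : coset_proj (gelt γ) = << coset_of γ >>.
Proof.
by rewrite /coset_proj [LHS]zactUU coset_actE mulg1.
Qed.

End Cosets.

HB.mixin Record isOrderedGammaGroup (Γ : groupType) G
    of GRing.Lmodule (group_ring Γ) G & Num.POrderedZmodule G := {
  og_leD : forall h g1 g2 : G, g2 <= g1 -> g2 + h <= g1 + h;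
  og_leZ : forall (γ : Γ) (g1 g2 : G),
    g2 <= g1 -> gelt γ *: g2 <= gelt γ *: g1
}.

#[short(type="ogroupType")]
HB.structure Definition OrderedGammaGroup (Γ : groupType) :=
  { G of isOrderedGammaGroup Γ G & GRing.Lmodule (group_ring Γ) G
       & Num.POrderedZmodule G }.

Definition directed (d : Order.disp_t) (T : preorderType d) :=
  forall x y : T, exists z : T, (x <= z)%O /\ (y <= z)%O.

Section OrderedGammaGroupDefs.
Context (Γ : groupType) (G : ogroupType Γ).

Definition Stab : set Γ := [set γ | forall x : G, gelt γ *: x = x].

Definition order_unit (u : G) :=
  0 <= u /\ forall x : G, exists a : group_ring Γ,
    [/\ malg_ge0 Γ a, a != 0 & x <= a *: u].

Definition generating_interval (D : set G) :=
  [/\ forall x, D x -> 0 <= x,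
      D 0,
      forall x y, D x -> D y -> exists z, [/\ D z, x <= z & y <= z],
      forall x y z, D x -> D y -> x <= z -> z <= y -> D z
    & forall x, 0 <= x -> exists (n : nat) (a : 'I_n -> group_ring Γ)
        (d : 'I_n -> G), (forall i, malg_ge0 Γ (a i) /\ D (d i)) /\
        x = \sum_i a i *: d i].

(* For n = 0 the cone is {0}, so that [simplicial_group] below also covers
   the zero group with the empty basis. *)
Definition simplicial_basis (Δ : set Γ) (n : nat) (x : 'I_n -> G) :=
  (forall i, [set γ | gelt γ *: x i = x i] = Δ) /\
  forall a b : 'I_n -> group_ring Γ,
    (forall i, malg_ge0 (coset Δ) (coset_proj Δ (a i))) ->
    (forall i, malg_ge0 (coset Δ) (coset_proj Δ (b i))) ->
    \sum_i a i *: x i = \sum_i b i *: x i <->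
    forall i, coset_proj Δ (a i - b i) = 0.

Definition simplicial_cone (Δ : set Γ) (n : nat) (x : 'I_n -> G) : set G :=
  [set y | exists a : 'I_n -> group_ring Γ,
    (forall i, malg_ge0 (coset Δ) (coset_proj Δ (a i))) /\
    y = \sum_i a i *: x i].

Definition simplicial_group (Δ : set Γ) :=
  subgroup Δ /\ exists (n : nat) (x : 'I_n -> G),
    [/\ simplicial_basis Δ x,
        [set y : G | 0 <= y] = simplicial_cone Δ x
      & directed G].

Definition SDP (Δ : set Γ) :=
  forall (n : nat) (a : 'I_n -> group_ring Γ) (x : 'I_n -> G),
    (forall i, 0 <= x i) -> \sum_i a i *: x i = 0 ->
  exists (m : nat) (b : 'I_n -> 'I_m -> group_ring Γ) (y : 'I_m -> G),
    [/\ (0 < m)%N,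
        forall i j, malg_ge0 Γ (b i j),
        forall j, 0 <= y j,
        forall i, x i = \sum_j b i j *: y j
      & forall j, \sum_i coset_proj Δ (a i * b i j) = 0].

Definition dimension_group :=
  directed G /\ exists Δ : set Γ, [/\ subgroup Δ, Δ `<=` Stab & SDP Δ].

(* An action of Z_2 given by its involution. *)
Definition star_action (s : G -> G) :=
  [/\ involutive s,
      {morph s : x y / x + y},
      {homo s : x y / x <= y}
    & forall (γ : Γ) (x : G), s (gelt γ *: x) = gelt γ *: s x].

Lemma trivial_star : star_action idfun.
Proof. by split. Qed.

End OrderedGammaGroupDefs.
Arguments Stab {Γ} G.
Arguments directed {d} T.
Arguments simplicial_group {Γ} G Δ.
Arguments SDP {Γ} G Δ.

(* Composition is in diagrammatic order: [ccomp f g] is f followed by g. *)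
Record category := Category {
  obj :> Type;
  hom : obj -> obj -> Type;
  idc : forall X, hom X X;
  ccomp : forall X Y Z, hom X Y -> hom Y Z -> hom X Z;
  ccompA : forall X Y Z T (f : hom X Y) (g : hom Y Z) (h : hom Z T),
    ccomp f (ccomp g h) = ccomp (ccomp f g) h;
  ccomp1f : forall X Y (f : hom X Y), ccomp (idc X) f = f;
  ccompf1 : forall X Y (f : hom X Y), ccomp f (idc Y) = f
}.
Arguments hom {c} X Y.
Arguments idc {c} X.
Arguments ccomp {c X Y Z} f g.

Record functor (C D : category) := Functor {
  fobj :> C -> D;
  fmap : forall X Y : C, hom X Y -> hom (fobj X) (fobj Y);
  fmap1 : forall X : C, fmap (idc X) = idc (fobj X);
  fmapM : forall (X Y Z : C) (f : hom X Y) (g : hom Y Z),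
    fmap (ccomp f g) = ccomp (fmap f) (fmap g)
}.
Arguments fmap {C D} _ {X Y} _.

Section DirectLimits.
Context (C : category).

Definition is_iso (X Y : C) (f : hom X Y) :=
  exists g : hom Y X, ccomp f g = idc X /\ ccomp g f = idc Y.

Record directed_system := DirectedSystem {
  ds_disp : Order.disp_t;
  ds_index : preorderType ds_disp;
  ds_inhabited : inhabited ds_index;
  ds_directed : directed ds_index;
  ds_obj :> ds_index -> C;
  ds_map : forall i j : ds_index, (i <= j)%O -> hom (ds_obj i) (ds_obj j);
  ds_map1 : forall (i : ds_index) (h : (i <= i)%O), ds_map h = idc (ds_obj i);
  ds_mapM : forall (i j k : ds_index)
    (hij : (i <= j)%O) (hjk : (j <= k)%O) (hik : (i <= k)%O),
    ccomp (ds_map hij) (ds_map hjk) = ds_map hik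
}.

Record cocone (S : directed_system) := Cocone {
  apex : C;
  leg : forall i : ds_index S, hom (S i) apex;
  legM : forall (i j : ds_index S) (h : (i <= j)%O),
    ccomp (ds_map h) (leg j) = leg i
}.

Definition is_direct_limit (S : directed_system) (c : cocone S) :=
  forall c' : cocone S, exists! h : hom (apex c) (apex c'),
    forall i, ccomp (leg c i) h = leg c' i.

(* A directed system, a cocone on it, and a morphism from X to its apex. *)
Record presentation (X : C) := Presentation {
  pr_system : directed_system;
  pr_cocone : cocone pr_system;
  pr_hom : hom X (apex pr_cocone)
}.

Definition iso_direct_limit (X : C) (p : presentation X) :=
  is_direct_limit (pr_cocone p) /\ is_iso (pr_hom p).

End DirectLimits.

Section FunctorImage.
Context (C D : category) (F : functor C D).

Lemma fmap_map1 (S : directed_system C) (i : ds_index S) (h : (i <= i)%O) :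
  fmap F (ds_map h) = idc (F (S i)).
Proof. by rewrite ds_map1 fmap1. Qed.

Lemma fmap_mapM (S : directed_system C) (i j k : ds_index S)
    (hij : (i <= j)%O) (hjk : (j <= k)%O) (hik : (i <= k)%O) :
  ccomp (fmap F (ds_map hij)) (fmap F (ds_map hjk)) = fmap F (ds_map hik).
Proof. by rewrite -fmapM (ds_mapM hij hjk hik). Qed.

Definition image_system (S : directed_system C) : directed_system D :=
  DirectedSystem (ds_inhabited S) (@ds_directed _ S)
    (ds_obj := fun i => F (S i)) (@fmap_map1 S) (@fmap_mapM S).

Lemma fmap_legM (S : directed_system C) (c : cocone S) (i j : ds_index S)
    (h : (i <= j)%O) :
  ccomp (fmap F (ds_map h)) (fmap F (leg c j)) = fmap F (leg c i).
Proof. by rewrite -fmapM legM. Qed.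

Definition image_cocone (S : directed_system C) (c : cocone S) :
    cocone (image_system S) :=
  @Cocone D (image_system S) (F (apex c)) (fun i => fmap F (leg c i))
    (@fmap_legM S c).

Definition image_presentation (X : C) (p : presentation X) :
    presentation (F X) :=
  @Presentation D (F X) _ (image_cocone (pr_cocone p)) (fmap F (pr_hom p)).

End FunctorImage.

(* The category whose morphisms are the functions satisfying [P]. *)
Section ConcreteCategory.
Context (T : Type) (car : T -> Type).
Context (P : forall X Y : T, (car X -> car Y) -> Prop).
Hypothesis P1 : forall X : T, P (X := X) (Y := X) idfun.
Hypothesis PM : forall (X Y Z : T) (f : car X -> car Y) (g : car Y -> car Z),
  P f -> P g -> P (g \o f).

Let chom (X Y : T) := {f : car X -> car Y | P f}.

Lemma chom_eq (X Y : T) (f g : chom X Y) : sval f = sval g -> f = g.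
Proof. exact: eq_sig_hprop (fun _ => @Prop_irrelevance _) f g. Qed.

Definition concrete : category.
Proof.
refine (@Category T chom (fun X => exist _ idfun (P1 X))
  (fun X Y Z f g => exist _ (sval g \o sval f) (PM (svalP f) (svalP g)))
  _ _ _).
- by move=> *; apply: chom_eq.
- by move=> *; apply: chom_eq.
- by move=> *; apply: chom_eq.
Defined.

End ConcreteCategory.

Section Categories.
Context (Γ : groupType).

Definition og_mor (G H : ogroupType Γ) (f : G -> H) :=
  linear f /\ forall x, 0 <= x -> 0 <= f x.

Lemma og_mor_id (G : ogroupType Γ) : og_mor (@idfun G).
Proof. by []. Qed.

Lemma og_mor_comp (G H K : ogroupType Γ) (f : G -> H) (g : H -> K) :
  og_mor f -> og_mor g -> og_mor (g \o f).
Proof.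
move=> [lf pf] [lg pg]; split=> [a x y | x x0] /=; first by rewrite lf lg.
exact/pg/pf.
Qed.

Definition OG : category := concrete og_mor_id og_mor_comp.

Record ogroup_u := OGroupU {
  ogu_group :> ogroupType Γ;
  ogu_unit : ogu_group;
  ogu_unitP : order_unit ogu_unit
}.

Definition ogu_mor (X Y : ogroup_u) (f : X -> Y) :=
  og_mor f /\ f (ogu_unit X) = ogu_unit Y.

Lemma ogu_mor_id (X : ogroup_u) : ogu_mor (X := X) (Y := X) idfun.
Proof. by []. Qed.

Lemma ogu_mor_comp (X Y Z : ogroup_u) (f : X -> Y) (g : Y -> Z) :
  ogu_mor f -> ogu_mor g -> ogu_mor (g \o f).
Proof.
by move=> [mf fu] [mg gu]; split; [exact: og_mor_comp | rewrite /= fu].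
Qed.

Definition OGu : category := concrete ogu_mor_id ogu_mor_comp.

Record ogroup_D := OGroupD {
  ogD_group :> ogroupType Γ;
  ogD_interval : set ogD_group;
  ogD_intervalP : generating_interval ogD_interval
}.

Definition ogD_mor (X Y : ogroup_D) (f : X -> Y) :=
  og_mor f /\ f @` ogD_interval (o := X) `<=` ogD_interval (o := Y).

Lemma ogD_mor_id (X : ogroup_D) : ogD_mor (X := X) (Y := X) idfun.
Proof. by split=> // _ [x Dx <-]. Qed.

Lemma ogD_mor_comp (X Y Z : ogroup_D) (f : X -> Y) (g : Y -> Z) :
  ogD_mor f -> ogD_mor g -> ogD_mor (g \o f).
Proof.
move=> [mf fD] [mg gD]; split; first exact: og_mor_comp.
by move=> _ [x Dx <-]; apply: gD; exists (f x) => //; apply: fD; exists x.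
Qed.

Definition OGD : category := concrete ogD_mor_id ogD_mor_comp.

Record ogroup_s := OGroupS {
  ogs_group :> ogroupType Γ;
  ogs_star : ogs_group -> ogs_group;
  ogs_starP : star_action ogs_star
}.

Definition ogs_mor (X Y : ogroup_s) (f : X -> Y) :=
  og_mor f /\ forall x, f (ogs_star x) = ogs_star (f x).

Lemma ogs_mor_id (X : ogroup_s) : ogs_mor (X := X) (Y := X) idfun.
Proof. by []. Qed.

Lemma ogs_mor_comp (X Y Z : ogroup_s) (f : X -> Y) (g : Y -> Z) :
  ogs_mor f -> ogs_mor g -> ogs_mor (g \o f).
Proof.
move=> [mf fs] [mg gs]; split; first exact: og_mor_comp.
by move=> x /=; rewrite fs gs.
Qed.

Definition OGs : category := concrete ogs_mor_id ogs_mor_comp.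

Record ogroup_us := OGroupUS {
  ogus_u :> ogroup_u;
  ogus_star : ogus_u -> ogus_u;
  ogus_starP : star_action ogus_star;
  ogus_star_unit : ogus_star (ogu_unit ogus_u) = ogu_unit ogus_u
}.

Definition ogus_mor (X Y : ogroup_us) (f : X -> Y) :=
  ogu_mor f /\ forall x, f (ogus_star x) = ogus_star (f x).

Lemma ogus_mor_id (X : ogroup_us) : ogus_mor (X := X) (Y := X) idfun.
Proof. by []. Qed.

Lemma ogus_mor_comp (X Y Z : ogroup_us) (f : X -> Y) (g : Y -> Z) :
  ogus_mor f -> ogus_mor g -> ogus_mor (g \o f).
Proof.
move=> [mf fs] [mg gs]; split; first exact: ogu_mor_comp.
by move=> x /=; rewrite fs gs.
Qed.

Definition OGus : category := concrete ogus_mor_id ogus_mor_comp.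

Record ogroup_Ds := OGroupDS {
  ogDs_D :> ogroup_D;
  ogDs_star : ogDs_D -> ogDs_D;
  ogDs_starP : star_action ogDs_star;
  ogDs_star_interval :
    ogDs_star @` ogD_interval (o := ogDs_D) = ogD_interval (o := ogDs_D)
}.

Definition ogDs_mor (X Y : ogroup_Ds) (f : X -> Y) :=
  ogD_mor f /\ forall x, f (ogDs_star x) = ogDs_star (f x).

Lemma ogDs_mor_id (X : ogroup_Ds) : ogDs_mor (X := X) (Y := X) idfun.
Proof. by split=> //; exact: ogD_mor_id. Qed.

Lemma ogDs_mor_comp (X Y Z : ogroup_Ds) (f : X -> Y) (g : Y -> Z) :
  ogDs_mor f -> ogDs_mor g -> ogDs_mor (g \o f).
Proof.
move=> [mf fs] [mg gs]; split; first exact: ogD_mor_comp.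
by move=> x /=; rewrite fs gs.
Qed.

Definition OGDs : category := concrete ogDs_mor_id ogDs_mor_comp.

Definition OGu_to_OG : functor OGu OG.
Proof.
refine (@Functor OGu OG (fun X => ogu_group X)
  (fun X Y f => exist _ (sval f) (svalP f).1) _ _);
by move=> *; apply: chom_eq.
Defined.

Definition OGD_to_OG : functor OGD OG.
Proof.
refine (@Functor OGD OG (fun X => ogD_group X)
  (fun X Y f => exist _ (sval f) (svalP f).1) _ _);
by move=> *; apply: chom_eq.
Defined.

Definition OGs_to_OG : functor OGs OG.
Proof.
refine (@Functor OGs OG (fun X => ogs_group X)
  (fun X Y f => exist _ (sval f) (svalP f).1) _ _);
by move=> *; apply: chom_eq.
Defined.

Definition OGus_to_OGu : functor OGus OGu.
Proof.
refine (@Functor OGus OGu (fun X => ogus_u X)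
  (fun X Y f => exist _ (sval f) (svalP f).1) _ _);
by move=> *; apply: chom_eq.
Defined.

Definition OGDs_to_OGD : functor OGDs OGD.
Proof.
refine (@Functor OGDs OGD (fun X => ogDs_D X)
  (fun X Y f => exist _ (sval f) (svalP f).1) _ _);
by move=> *; apply: chom_eq.
Defined.

Definition trivial_s (G : ogroupType Γ) : OGs := OGroupS (trivial_star G).

Definition trivial_us (X : ogroup_u) : OGus :=
  @OGroupUS X idfun (trivial_star X) erefl.

Definition trivial_Ds (X : ogroup_D) : OGDs :=
  @OGroupDS X idfun (trivial_star X) (image_id _).

Definition simplicial_limit (Δ : set Γ) (G : OG) (p : presentation G) :=
  (forall i, simplicial_group (pr_system p i) Δ) /\ iso_direct_limit p.

End Categories.

(* Main.v *)
From HB Require Import structures.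
From mathcomp Require Import all_boot all_order all_algebra.
From mathcomp Require Import finmap monalg.
From mathcomp Require Import boolp classical_sets.
Require Import Defs.

(** Let [Δ] be the normal closure of [Δ0]. Since [Stab G] is normal, [Δ] acts
    trivially on [G], and the decomposition property passes from [Δ0] to [Δ];
    so [G] is a module over [Z[Γ/Δ]], and the simplicial groups wanted are the
    free modules of finite rank over this ring. They have the universal
    property of free modules for every module on which [Δ] acts trivially
    ([free_map]), which applies to maps to [G] and to maps between free modules.

    The proof follows the Effros-Handelman-Shen theorem. The decomposition
    property says that a positive map [θ : F -> G] from a free module factors
    through another free module in such a way that a given element of [ker θ]
    dies ([kill_relation]). As [Z[Γ]] is noetherian, [ker θ] is finitely
    generated and can be killed at once ([kill_kernel]). Killing relations also
    produces inequalities: elements of [F] with positive image in [G] become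
    positive in the new free module ([kill_kernel_positive]).

    The three kinds of presentation are obtained from one directed system,
    which depends on a set [D] of positive elements of [G]: the singleton of
    an order unit, a generating interval, or the whole cone. An index of the
    system, called a stage, consists of a positive map [F -> G], an order unit
    [u] of [F] mapped into [D], a natural number, and a subset of [F], its
    section, on which the map to [G] is injective. From a stage to another one
    of larger rank, only positive maps over [G] which land in the section of
    the target and send the unit below the unit are allowed. At most one such
    map exists, which is what makes the system functorial without any choice of
    compatible maps; and since a kernel can be killed, the image of a killing
    map being a section, such maps exist in abundance ([stage_exists],
    [stage_advance]). When [D] is the singleton of an order unit, units are
    mapped to units, again by injectivity on sections. When [D] is a
    generating interval, the intervals [[0, u]] form the system of generating
    intervals.

    In each of the categories, the limit property is then a statement about
    underlying sets ([concrete_limit]): the maps to [G] are jointly surjective,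
    and two elements with the same image are identified by any transition of
    larger rank. The trivial involution on [G] is carried by trivial
    involutions on the stages, and the presentations without involutions are
    the images of those with involutions under the forgetful functors. *)

Set Implicit Arguments.
Unset Strict Implicit.
Unset Printing Implicit Defensive.

Import Order.TTheory GRing.Theory Num.Theory.

Local Open Scope classical_set_scope.
Local Open Scope ring_scope.

(** * Nonnegative elements of the group ring and of permutation modules *)

Section NonnegativeCombinations.
Context (K : choiceType).
Implicit Types (x y : {malg int[K]}).

Lemma malg_ge0D x y : malg_ge0 K x -> malg_ge0 K y -> malg_ge0 K (x + y).
Proof. by move=> hx hy k; rewrite mcoeffD addr_ge0. Qed.

Lemma malg_ge0U k : malg_ge0 K << k >>.
Proof. by move=> k'; rewrite mcoeffU mulrn_wge0. Qed.

Lemma malg_ge0_sum (I : Type) (r : seq I) (F : I -> {malg int[K]}) :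
  (forall i, malg_ge0 K (F i)) -> malg_ge0 K (\sum_(i <- r) F i).
Proof.
move=> hF; elim/big_rec: _ => [k|i x _ hx]; first by rewrite mcoeff0.
exact: malg_ge0D.
Qed.

Lemma malg_ge0Mz x (c : int) : 0 <= c -> malg_ge0 K x -> malg_ge0 K (x *~ c).
Proof. by case: c => // n _ hx k; rewrite -pmulrn mcoeffMn mulrn_wge0. Qed.

Lemma malgE x : x = \sum_(k <- msupp x) << k >> *~ x@_k.
Proof.
rewrite {1}[x]monalgE; apply: eq_bigr => k _.
by rewrite -(raddfMz (mkmalgU k)) intz.
Qed.

Lemma malg_upper_bound x : exists2 y, malg_ge0 K y & malg_ge0 K (y - x).
Proof.
exists (\sum_(k <- msupp x) << k >> *~ `|x@_k|).
  by apply: malg_ge0_sum => k; apply: malg_ge0Mz => //; apply: malg_ge0U.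
rewrite [X in _ - X]malgE -sumrB; apply: malg_ge0_sum => k.
rewrite -mulrzBr; apply: malg_ge0Mz; last exact: malg_ge0U.
by rewrite subr_ge0 ler_norm.
Qed.

End NonnegativeCombinations.

Lemma zlin_ge0 (K L : choiceType) (f : K -> {malg int[L]}) x :
  (forall k, malg_ge0 L (f k)) -> malg_ge0 K x -> malg_ge0 L (zlin f x).
Proof. by move=> hf hx; apply: malg_ge0_sum => k; apply: malg_ge0Mz. Qed.

Lemma zact_ge0 (Γ : groupType) (K : choiceType) (act : Γ -> K -> K) a x :
  malg_ge0 Γ a -> malg_ge0 K x -> malg_ge0 K (zact act a x).
Proof.
move=> ha hx; apply: zlin_ge0 => // γ.
by apply: zlin_ge0 => // k; apply: malg_ge0U.
Qed.

Lemma gelt_ge0 (Γ : groupType) (γ : Γ) : malg_ge0 Γ (gelt γ).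
Proof. exact: malg_ge0U. Qed.

Lemma gelt_scaleE (Γ : groupType) (M : lmodType (group_ring Γ))
    (a : group_ring Γ) (x : M) :
  a *: x = \sum_(γ <- msupp a) (gelt γ *: x) *~ a@_γ.
Proof.
have {1}-> : a = \sum_(γ <- msupp a) gelt γ *~ a@_γ by exact: (malgE a).
by rewrite scaler_suml; apply: eq_bigr => γ _; rewrite scalerMzl.
Qed.

Section GammaLinear.
Context (Γ : groupType) (M : lmodType (group_ring Γ)).

(** Since the group elements span the group ring over the integers,
    an additive map is linear as soon as it is equivariant. *)
Lemma equivariant_linear (N : lmodType (group_ring Γ)) (f : {additive M -> N}) :
  (forall γ x, f (gelt γ *: x) = gelt γ *: f x) -> linear f.
Proof.
move=> hf a x y; rewrite raddfD; congr (_ + _).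
rewrite [in LHS]gelt_scaleE [RHS]gelt_scaleE raddf_sum; apply: eq_bigr => γ _.
by rewrite raddfMz hf.
Qed.

Lemma gelt_scaleM (γ δ : Γ) (x : M) :
  gelt (γ * δ)%g *: x = gelt γ *: (gelt δ *: x).
Proof. by rewrite geltM scalerA. Qed.

Lemma gelt_scale1 (x : M) : gelt (1%g : Γ) *: x = x.
Proof. by rewrite gelt1 scale1r. Qed.

End GammaLinear.

Section OrderedGroups.
Context (Γ : groupType) (G : ogroupType Γ).
Implicit Types (x y z : G) (a : group_ring Γ).

Lemma og_subr_ge0 x y : (0 <= y - x) = (x <= y).
Proof.
apply/idP/idP => h.
  by have := og_leD x _ _ h; rewrite add0r subrK.
by have := og_leD (- x) _ _ h; rewrite subrr.
Qed.

Lemma og_lerD x y z t : x <= y -> z <= t -> x + z <= y + t.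
Proof.
move=> xy zt; apply: le_trans (og_leD z _ _ xy) _.
by rewrite ![y + _]addrC og_leD.
Qed.

Lemma og_addr_ge0 x y : 0 <= x -> 0 <= y -> 0 <= x + y.
Proof. by move=> hx hy; rewrite -[X in X <= _](addr0 0) og_lerD. Qed.

Lemma og_sumr_ge0 (I : Type) (r : seq I) (F : I -> G) :
  (forall i, 0 <= F i) -> 0 <= \sum_(i <- r) F i.
Proof.
by move=> hF; elim/big_rec: _ => [|i x _ hx]; rewrite ?lexx // og_addr_ge0.
Qed.

Lemma og_scale_ge0 a x : malg_ge0 Γ a -> 0 <= x -> 0 <= a *: x.
Proof.
move=> ha hx; rewrite gelt_scaleE; apply: og_sumr_ge0 => γ.
have := ha γ; case: (a@_γ) => // n _; rewrite -pmulrn.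
have hγ : 0 <= gelt γ *: x by rewrite -(scaler0 _ (gelt γ)) og_leZ.
by elim: n => [|n IH]; rewrite ?mulr0n ?lexx // mulrS og_addr_ge0.
Qed.

Lemma og_ler_scale a x y : malg_ge0 Γ a -> x <= y -> a *: x <= a *: y.
Proof. by move=> ha h; rewrite -og_subr_ge0 -scalerBr og_scale_ge0 ?og_subr_ge0. Qed.

End OrderedGroups.

(** * Cosets *)

Section Cosets.
Context (Γ : groupType) (Δ : set Γ).

Lemma subgroupV γ : subgroup Δ -> Δ γ -> Δ γ^-1%g.
Proof. by move=> [Δ1 ΔV] /(ΔV _ _ Δ1); rewrite div1g. Qed.

Lemma subgroupM γ δ : subgroup Δ -> Δ γ -> Δ δ -> Δ (γ * δ)%g.
Proof.
move=> hΔ hγ /(subgroupV hΔ) hδ; case: (hΔ) => _ /(_ _ _ hγ hδ).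
by rewrite invgK.
Qed.

Lemma coset_of_eq γ δ : subgroup Δ ->
  coset_of Δ γ = coset_of Δ δ <-> Δ (γ^-1 * δ)%g.
Proof.
move=> hΔ; split=> [/(congr1 (@coset_set _ _)) /= e | h].
  have : lcoset Δ δ δ by exists 1%g; [exact: hΔ.1 | rewrite mulg1].
  by rewrite -e => -[ε hε <-]; rewrite mulKg.
apply/val_inj/seteqP; split=> _ [ε hε <-] /=.
  exists (δ^-1 * γ * ε)%g; last by rewrite !mulgA mulgV mul1g.
  apply: (subgroupM hΔ) => //.
  by rewrite -[X in Δ X]invgK invgM invgK; apply: (subgroupV hΔ).
by exists (γ^-1 * δ * ε)%g; [apply: (subgroupM hΔ h) | rewrite !mulgA mulgV mul1g].
Qed.

Lemma coset_rep_subproof (C : coset Δ) : exists γ, coset_of Δ γ = C.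
Proof.
by case: C => C hC; case/set_mem: (hC) => γ _ e; exists γ; apply/val_inj.
Qed.
Definition coset_rep (C : coset Δ) : Γ := sval (cid (coset_rep_subproof C)).
Lemma coset_repK C : coset_of Δ (coset_rep C) = C.
Proof. by rewrite /coset_rep; case: cid. Qed.

Lemma coset_projB a b : coset_proj Δ (a - b) = coset_proj Δ a - coset_proj Δ b.
Proof. exact: scalerBl. Qed.

Lemma coset_projM a b : coset_proj Δ (a * b) = a *: coset_proj Δ b.
Proof. by rewrite /coset_proj scalerA. Qed.

Lemma coset_proj_ge0 a : malg_ge0 Γ a -> malg_ge0 (coset Δ) (coset_proj Δ a).
Proof. by move=> ha; apply: zact_ge0 => //; apply: malg_ge0U. Qed.

Definition coset_lift (x : perm_module Δ) : group_ring Γ :=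
  zlin (fun C => gelt (coset_rep C)) x.

Lemma coset_liftK x : coset_proj Δ (coset_lift x) = x.
Proof.
rewrite /coset_proj /coset_lift /zlin scaler_suml [RHS]malgE.
apply: eq_bigr => C _.
rewrite -scalerMzl; congr (_ *~ _).
by rewrite -{2}(coset_repK C); apply: coset_projU.
Qed.

Lemma coset_lift_ge0 x : malg_ge0 (coset Δ) x -> malg_ge0 Γ (coset_lift x).
Proof. by apply: zlin_ge0 => C; apply: gelt_ge0. Qed.

End Cosets.

(** * Free modules over the permutation module of a subgroup *)

(** For normal [Δ] these are the free modules over the ring [Z[Γ/Δ]]; writing
    them with permutation modules avoids constructing that ring. *)
Definition free_module (Γ : groupType) (Δ : set Γ) (n : nat) : Type :=
  {ffun 'I_n -> perm_module Δ}.

Section FreeModule.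
Context (Γ : groupType) (Δ : set Γ) (n : nat).
Local Notation F := (free_module Δ n).
HB.instance Definition _ := GRing.Lmodule.on F.
Implicit Types (x y z : F).

Definition free_le x y := `[< forall i, malg_ge0 (coset Δ) (y i - x i) >].

Lemma free_le_refl : reflexive free_le.
Proof. by move=> x; apply/asboolP => i C; rewrite subrr mcoeff0. Qed.

Lemma free_le_anti : antisymmetric free_le.
Proof.
move=> x y /andP[/asboolP xy /asboolP yx]; apply/ffunP => i; apply/malgP => C.
have := xy i C; have := yx i C; rewrite !mcoeffB !subr_ge0 => h1 h2.
by apply/le_anti; rewrite h1 h2.
Qed.

Lemma free_le_trans : transitive free_le.
Proof.
move=> y x z /asboolP xy /asboolP yz; apply/asboolP => i.
have -> : z i - x i = (z i - y i) + (y i - x i) by rewrite addrA subrK.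
exact: malg_ge0D.
Qed.

HB.instance Definition _ := Order.Le_isPOrder.Build ring_display F
  free_le_refl free_le_anti free_le_trans.

Lemma free_leP x y :
  reflect (forall i, malg_ge0 (coset Δ) (y i - x i)) (x <= y).
Proof. exact: asboolP. Qed.

Lemma free_scaleE a x i : (a *: x) i = a *: (x i : perm_module Δ).
Proof. by rewrite ffunE. Qed.

Lemma free_leD z x y : y <= x -> y + z <= x + z.
Proof.
move=> /free_leP h; apply/free_leP => i.
by rewrite !ffunE opprD addrACA subrr addr0.
Qed.

Lemma free_leZ γ x y : y <= x -> gelt γ *: y <= gelt γ *: x.
Proof.
move=> /free_leP h; apply/free_leP => i; rewrite !free_scaleE -scalerBr.
by apply: zact_ge0 => //; apply: gelt_ge0.
Qed.

HB.instance Definition _ := isOrderedGammaGroup.Build Γ F free_leD free_leZ.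

Lemma free_ge0P x : reflect (forall i, malg_ge0 (coset Δ) (x i)) (0 <= x).
Proof.
by apply: (iffP (free_leP _ _)) => h i; move: (h i); rewrite ffunE subr0.
Qed.

Definition free_basis (i : 'I_n) : F :=
  [ffun j => if i == j then coset_proj Δ 1 else 0].

Lemma free_combE (a : 'I_n -> group_ring Γ) j :
  (\sum_i a i *: free_basis i) j = coset_proj Δ (a j).
Proof.
rewrite sum_ffunE (bigD1 j) //= big1 ?addr0 => [|i ij].
  by rewrite free_scaleE ffunE eqxx -coset_projM mulr1.
by rewrite free_scaleE ffunE (negPf ij) scaler0.
Qed.

Lemma free_combK x : x = \sum_i coset_lift (x i) *: free_basis i.
Proof. by apply/ffunP => j; rewrite free_combE coset_liftK. Qed.

Lemma free_basis_ge0 i : 0 <= free_basis i.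
Proof.
apply/free_ge0P => j; rewrite ffunE; case: ifP => _.
  by apply: coset_proj_ge0; rewrite -gelt1; apply: gelt_ge0.
by move=> C; rewrite mcoeff0.
Qed.

Lemma free_directed : directed F.
Proof.
move=> x y.
have bd (z : F) : exists2 t : F, 0 <= t & z <= t.
  have h i := malg_upper_bound (z i).
  pose t i := s2val (cid2 (h i)).
  exists [ffun i => t i : perm_module Δ].
    by apply/free_ge0P => i; rewrite ffunE /t; case: cid2.
  by apply/free_leP => i; rewrite ffunE /t; case: cid2.
have [s s0 xs] := bd x; have [t t0 yt] := bd y.
exists (s + t); split.
  by rewrite -[x]addr0; apply: og_lerD.
by rewrite -[y]add0r; apply: og_lerD.
Qed.

Lemma free_basis_stab i : subgroup Δ ->
  [set γ | gelt γ *: free_basis i = free_basis i] = Δ.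
Proof.
move=> hΔ.
have E γ : gelt γ *: free_basis i = free_basis i <->
    coset_of Δ γ = coset_of Δ 1%g.
  have p1 : coset_proj Δ 1 = << coset_of Δ 1%g >> by rewrite -gelt1 coset_projU.
  have pγ : gelt γ *: coset_proj Δ 1 = << coset_of Δ γ >>.
    by rewrite -coset_projM mulr1 coset_projU.
  split=> [/ffunP /(_ i) | e].
    rewrite free_scaleE ffunE eqxx pγ p1 => /malgP /(_ (coset_of Δ γ)).
    by rewrite !mcoeffU eqxx; case: eqP.
  apply/ffunP => j; rewrite free_scaleE ffunE.
  by case: ifP => _; rewrite ?scaler0 // pγ p1 e.
apply/seteqP; split=> γ /=.
  by move/E/(coset_of_eq _ _ hΔ); rewrite mulg1 => /(subgroupV hΔ); rewrite invgK.
move=> h; apply/E/(coset_of_eq _ _ hΔ); rewrite mulg1.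
exact: subgroupV.
Qed.

Lemma free_simplicial : subgroup Δ -> simplicial_group F Δ.
Proof.
move=> hΔ; split=> //; exists n, free_basis; split; last exact: free_directed.
  split=> [i | a b _ _]; first exact: free_basis_stab.
  split=> [e i | h]; first by rewrite coset_projB -!free_combE e subrr.
  apply/ffunP => i; apply/eqP; rewrite !free_combE -subr_eq0 -coset_projB.
  by rewrite h.
apply/seteqP; split=> x /=.
  move/free_ge0P => h; exists (fun i => coset_lift (x i)); split; last first.
    exact: free_combK.
  by move=> i; rewrite coset_liftK.
by move=> [a [ha ->]]; apply/free_ge0P => i; rewrite free_combE.
Qed.

End FreeModule.

(** * The universal property of free modules *)

Section UniversalProperty.
Context (Γ : groupType) (Δ : set Γ) (n : nat).
Local Notation F := (free_module Δ n).

Lemma free_ext (M : lmodType (group_ring Γ)) (f g : {linear F -> M}) :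
  (forall i, f (free_basis Δ i) = g (free_basis Δ i)) -> f =1 g.
Proof.
move=> h x; rewrite (free_combK x) !linear_sum; apply: eq_bigr => i _.
by rewrite !linearZ h.
Qed.

(** A generator may be sent anywhere, because its stabilizer [Δ] acts trivially
    on the target: the coset of [γ] goes to the translate by [γ] of the image
    of the generator, whatever the representative. *)
Lemma free_map (M : lmodType (group_ring Γ)) (x : 'I_n -> M) :
    subgroup Δ -> (forall δ (y : M), Δ δ -> gelt δ *: y = y) ->
  exists f : {linear F -> M}, forall i, f (free_basis Δ i) = x i.
Proof.
move=> hΔ trivM.
have repM γ m : gelt (coset_rep (coset_of Δ γ)) *: m = gelt γ *: m :> M.
  have /esym/(coset_of_eq _ _ hΔ) := coset_repK (coset_of Δ γ).
  by move=> /(trivM _ m) {2}<-; rewrite -gelt_scaleM mulgA mulgV mul1g.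
pose lift m (y : perm_module Δ) : M := zlin (fun C => gelt (coset_rep C) *: m) y.
have liftZ m γ y : lift m (gelt γ *: y) = gelt γ *: lift m y.
  rewrite [y in LHS]malgE scaler_sumr /lift raddf_sum scaler_sumr.
  apply: eq_bigr => C _; rewrite -[C]coset_repK.
  have e : gelt γ *: (<< coset_of Δ (coset_rep C) >> : perm_module Δ) =
      << coset_of Δ (γ * coset_rep C)%g >>.
    by rewrite [LHS]zactUU coset_actE.
  rewrite -!scalerMzr e raddfMz /= zlinU mulr1z !repM.
  by rewrite gelt_scaleM.
pose f (y : F) : M := \sum_i lift (x i) (y i).
have fB : zmod_morphism f.
  move=> y z; rewrite /f -sumrB; apply: eq_bigr => i _.
  by rewrite !ffunE /lift raddfB.
pose fa : {additive F -> M} := HB.pack f (GRing.isZmodMorphism.Build _ _ f fB).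
have fL : linear f.
  apply: (@equivariant_linear _ _ _ fa) => γ y /=.
  rewrite /f scaler_sumr; apply: eq_bigr => i _.
  by rewrite free_scaleE liftZ.
pose fl : {linear F -> M} := HB.pack f (GRing.isLinear.Build _ _ _ _ f fL).
exists fl => i /=; rewrite /f (bigD1 i) //= big1 ?addr0 => [|j ji].
  rewrite ffunE eqxx -gelt1 coset_projU /lift zlinU mulr1z repM.
  exact: gelt_scale1.
by rewrite ffunE eq_sym (negPf ji) /lift raddf0.
Qed.

End UniversalProperty.

(** * Normal subgroups *)

Section NormalSubgroups.
Context (Γ : groupType).

Lemma normal_closureP (Δ0 : set Γ) :
  normal_subgroup (normal_closure Δ0) /\ Δ0 `<=` normal_closure Δ0.
Proof.
split; last by move=> γ hγ N [_ hN]; apply: hN.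
split; first split=> [N [[[N1 _] _] _] // | γ δ hγ hδ N hN].
  by have [[[_ NV] _] _] := hN; apply: NV; [apply: hγ | apply: hδ].
by move=> γ δ hδ N hN; have [[_ NJ] _] := hN; apply: NJ; apply: hδ.
Qed.

Lemma normal_closure_min (Δ0 N : set Γ) :
  normal_subgroup N -> Δ0 `<=` N -> normal_closure Δ0 `<=` N.
Proof. by move=> nN sN γ; apply. Qed.

Lemma Stab_normal (G : ogroupType Γ) : normal_subgroup (Stab G).
Proof.
split; first split=> [x | γ δ hγ hδ x]; first exact: gelt_scale1.
  by rewrite -{1}[x]hδ -gelt_scaleM mulgVK hγ.
move=> γ δ hδ x; rewrite conjgE !gelt_scaleM hδ -gelt_scaleM mulVg.
exact: gelt_scale1.
Qed.

(** Normality moves an element of [Δ] past the representative of a coset, where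
    the coset absorbs it. *)
Lemma free_trivial (Δ : set Γ) n (y : free_module Δ n) δ :
  normal_subgroup Δ -> Δ δ -> gelt δ *: y = y.
Proof.
move=> [hΔ nΔ] hδ; apply/ffunP => i; rewrite free_scaleE.
rewrite [y i]malgE scaler_sumr; apply: eq_bigr => C _.
rewrite -scalerMzr; congr (_ *~ _); rewrite [LHS]zactUU; congr << _ >>.
rewrite -(coset_repK C) coset_actE; apply/(coset_of_eq _ _ hΔ).
have -> : ((δ * coset_rep C)^-1 * coset_rep C)%g = (δ^-1 ^ coset_rep C)%g.
  by rewrite conjgE invgM mulgA.
by apply: nΔ; apply: (subgroupV hΔ).
Qed.

(** The projection to [Z[Γ/Δ]] factors through [Z[Γ/Δ0]]; this is how relations
    modulo [Δ0] become relations modulo the larger group [Δ]. *)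
Lemma coset_proj_sub (Δ0 Δ : set Γ) (a : group_ring Γ) :
    subgroup Δ0 -> subgroup Δ -> Δ0 `<=` Δ ->
  coset_proj Δ0 a = 0 -> coset_proj Δ a = 0.
Proof.
move=> h0 hΔ sub e.
pose f (y : perm_module Δ0) : perm_module Δ :=
  zlin (fun C => << coset_of Δ (coset_rep C) >>) y.
have <- : f (coset_proj Δ0 a) = coset_proj Δ a.
  rewrite /coset_proj [in LHS]gelt_scaleE [RHS]gelt_scaleE /f raddf_sum.
  apply: eq_bigr => γ _; rewrite raddfMz; congr (_ *~ _).
  rewrite ![gelt γ *: _]coset_projU /= zlinU mulr1z; congr << _ >>.
  apply/(coset_of_eq _ _ hΔ).
  have /(coset_of_eq _ _ h0)/sub := coset_repK (coset_of Δ0 γ).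
  by [].
by rewrite e /f raddf0.
Qed.

End NormalSubgroups.

(** * Submodules of free modules are finitely generated *)

Definition submodule (R : pzRingType) (M : lmodType R) (N : set M) :=
  N 0 /\ forall a x y, N x -> N y -> N (a *: x + y).

Section Submodules.
Context (R : pzRingType) (M : lmodType R) (N : set M).
Context (hN : submodule N).

Lemma submoduleD x y : N x -> N y -> N (x + y).
Proof. by move=> hx hy; rewrite -[x]scale1r; apply: hN.2. Qed.

Lemma submoduleZ a x : N x -> N (a *: x).
Proof. by move=> hx; rewrite -[_ *: _]addr0; apply: hN.2 => //; apply: hN.1. Qed.

Lemma submoduleB x y : N x -> N y -> N (x - y).
Proof.
by move=> hx hy; apply: submoduleD => //; rewrite -scaleN1r; apply: submoduleZ.
Qed.

Lemma submodule_sum (I : Type) (r : seq I) (F : I -> M) :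
  (forall i, N (F i)) -> N (\sum_(i <- r) F i).
Proof.
by move=> hF; elim/big_rec: _ => [|i x _]; [apply: hN.1 | apply: submoduleD].
Qed.

End Submodules.

Lemma kernel_submodule (R : pzRingType) (M M' : lmodType R)
  (f : {linear M -> M'}) : submodule [set x | f x = 0].
Proof.
by split=> [|a x y /= hx hy]; rewrite /= ?linear0 // linearP hx hy scaler0 addr0.
Qed.

(** The usual induction on the number of coordinates that are allowed to
    be nonzero. The leading coefficients of a submodule are lifted to the
    group ring, where they form a left ideal. *)
Lemma free_noetherian (Γ : groupType) (Δ : set Γ) n
    (N : set (free_module Δ n)) :
    left_noetherian (group_ring Γ) -> submodule N ->
  exists s : seq (free_module Δ n), (forall x, x \in s -> N x) /\
    forall K, submodule K -> (forall x, x \in s -> K x) -> N `<=` K.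
Proof.
move=> noeth hN.
suff gen k : (k <= n)%N -> exists s : seq (free_module Δ n),
    (forall x, x \in s -> N x) /\
    forall K, submodule K -> (forall x, x \in s -> K x) ->
    forall x, N x -> (forall i : 'I_n, (k <= i)%N -> x i = 0) -> K x.
  have [s [sN sK]] := gen n (leqnn n); exists s; split=> // K hK Ks x Nx.
  by apply: (sK K) => // i; rewrite leqNgt ltn_ord.
elim: k => [_ | k IH kn].
  exists [::]; split=> // K hK _ x _ x0.
  have -> : x = 0 by apply/ffunP => i; rewrite x0 // ffunE.
  exact: hK.1.
have [s [sN sK]] := IH (ltnW kn); pose k' := Ordinal kn.
pose J := [set a : group_ring Γ | exists x, [/\ N x,
  forall i : 'I_n, (k < i)%N -> x i = 0 & x k' = coset_proj Δ a]].
have JI : left_ideal J.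
  split.
  - exists 0; split=> [|i _|]; first exact: hN.1; rewrite ffunE //.
    by rewrite /coset_proj scale0r.
  - move=> a b [x [Nx x0 xa]] [y [Ny y0 yb]]; exists (x + y); split.
    + exact: submoduleD.
    + by move=> i ki; rewrite ffunE x0 // y0 // addr0.
    + by rewrite ffunE xa yb /coset_proj scalerDl.
  - move=> a b [x [Nx x0 xb]]; exists (a *: x); split.
    + exact: submoduleZ.
    + by move=> i ki; rewrite free_scaleE x0 // scaler0.
    + by rewrite free_scaleE xb coset_projM.
have [r [c Jc]] := noeth J JI.
have cJ t : J (c t).
  rewrite Jc; exists (fun t' => (t' == t)%:R).
  rewrite (bigD1 t) //= eqxx mul1r big1 ?addr0 // => t' /negPf ->.
  by rewrite mul0r.
pose z t := sval (cid (cJ t)).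
have zP t : [/\ N (z t), forall i : 'I_n, (k < i)%N -> z t i = 0
    & z t k' = coset_proj Δ (c t)] by rewrite /z; case: cid.
exists (s ++ [seq z t | t : 'I_r]); split.
  move=> x; rewrite mem_cat => /orP[/sN // | /mapP[t _ ->]].
  by have [] := zP t.
move=> K hK Ks x Nx x0.
have Kz t : K (z t).
  by apply: Ks; rewrite mem_cat; apply/orP; right; apply: map_f; rewrite mem_enum.
have : J (coset_lift (x k')) by exists x; split=> //; rewrite coset_liftK.
rewrite Jc => -[b eb].
(* [x] and [y] agree at the coordinate [k'], so the induction hypothesis
   applies to [x - y]. *)
pose y := \sum_t b t *: z t.
have Ky : K y by apply: submodule_sum => // t; apply: submoduleZ.
have Ny : N y.
  by apply: submodule_sum => // t; apply: submoduleZ => //; have [] := zP t.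
rewrite -(subrK y x); apply: submoduleD => //; apply: sK => //.
- by move=> w hw; apply: Ks; rewrite mem_cat hw.
- exact: submoduleB.
move=> i; rewrite leq_eqVlt => /orP[/eqP ki | ki]; last first.
  rewrite !ffunE x0 // sum_ffunE big1 ?subr0 // => t _.
  by have [_ z0 _] := zP t; rewrite free_scaleE z0 // scaler0.
have -> : i = k' by apply/val_inj.
rewrite !ffunE sum_ffunE -[x k']coset_liftK eb /coset_proj scaler_suml.
rewrite -sumrB big1 // => t _; have [_ _ zc] := zP t.
by rewrite free_scaleE zc -coset_projM subrr.
Qed.

(** * Killing the kernel of a positive map *)

Definition positive (Γ : groupType) (G H : ogroupType Γ) (f : G -> H) :=
  forall x, 0 <= x -> 0 <= f x.

Lemma positive_comp (Γ : groupType) (G H K : ogroupType Γ)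
    (f : G -> H) (g : H -> K) :
  positive f -> positive g -> positive (g \o f).
Proof. by move=> hf hg x hx; apply/hg/hf. Qed.

Lemma positive_le (Γ : groupType) (G H : ogroupType Γ) (f : {linear G -> H})
  x y : positive f -> x <= y -> f x <= f y.
Proof. by move=> pf h; rewrite -og_subr_ge0 -linearB pf // og_subr_ge0. Qed.

Lemma free_positive (Γ : groupType) (Δ : set Γ) n (G : ogroupType Γ)
    (f : {linear free_module Δ n -> G}) :
  (forall i, 0 <= f (free_basis Δ i)) -> positive f.
Proof.
move=> hf x /free_ge0P hx; rewrite (free_combK x) linear_sum.
apply: og_sumr_ge0 => i; rewrite linearZ; apply: og_scale_ge0 => //.
exact: coset_lift_ge0.
Qed.

Section Factorizations.
Context (Γ : groupType) (Δ : set Γ) (G : ogroupType Γ).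
Local Notation F := (free_module Δ).

Definition factors n m (θ : F n -> G) (φ : F n -> F m) (θ' : F m -> G) :=
  [/\ positive φ, positive θ' & θ' \o φ =1 θ].

Lemma factors_comp n m k (θ : F n -> G) (φ : F n -> F m) (θ' : F m -> G)
    (ψ : F m -> F k) (θ'' : F k -> G) :
  factors θ φ θ' -> factors θ' ψ θ'' -> factors θ (ψ \o φ) θ''.
Proof.
move=> [pφ _ e] [pψ pθ'' e']; split=> //; first exact: positive_comp.
by move=> x; rewrite -e /= -e'.
Qed.

Context (normΔ : normal_subgroup Δ) (stabΔ : Δ `<=` Stab G).

Let free_mapG n (x : 'I_n -> G) :
  exists f : {linear F n -> G}, forall i, f (free_basis Δ i) = x i.
Proof. by apply: free_map; [exact: normΔ.1 | move=> δ y /stabΔ]. Qed.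

Let free_mapF n m (x : 'I_n -> F m) :
  exists f : {linear F n -> F m}, forall i, f (free_basis Δ i) = x i.
Proof. by apply: free_map; [exact: normΔ.1 | move=> δ y; apply: free_trivial]. Qed.

(** The simplicial decomposition property read as a factorization: writing
    [z = \sum_i a_i e_i], the relation [\sum_i a_i θ(e_i) = 0] yields
    [θ(e_i) = \sum_j b_ij y_j], and the maps are [e_i |-> (π b_ij)_j] and
    [e_j |-> y_j]. *)
Lemma kill_relation (Δ0 : set Γ) n (θ : {linear F n -> G}) z :
    subgroup Δ0 -> Δ0 `<=` Δ -> SDP G Δ0 -> positive θ -> θ z = 0 ->
  exists m (φ : {linear F n -> F m}) (θ' : {linear F m -> G}),
    factors θ φ θ' /\ φ z = 0.
Proof.
move=> h0 sub sdp pθ z0.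
pose a i := coset_lift (z i).
have rel : \sum_i a i *: θ (free_basis Δ i) = 0.
  rewrite -[RHS]z0 [in RHS](free_combK z) linear_sum; apply: eq_bigr => i _.
  by rewrite linearZ.
have [m [b [y [_ b0 y0 xE bE]]]] :=
  sdp n a _ (fun i => pθ _ (free_basis_ge0 Δ i)) rel.
have [θ' hθ'] := free_mapG y.
have [φ hφ] := free_mapF (fun i => \sum_j b i j *: free_basis Δ j).
exists m, φ, θ'; split; first split.
- apply: free_positive => i; rewrite hφ; apply: og_sumr_ge0 => j.
  by apply: og_scale_ge0 => //; apply: free_basis_ge0.
- by apply: free_positive => j; rewrite hθ'.
- apply: (@free_ext _ _ _ _ (θ' \o φ)%FUN) => i; rewrite /= hφ linear_sum xE.
  by apply: eq_bigr => j _; rewrite linearZ hθ'.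
apply/ffunP => j; rewrite (free_combK z) linear_sum sum_ffunE.
rewrite [in RHS]ffunE -[RHS](@coset_proj_sub _ Δ0 _ (\sum_i a i * b i j)) //.
- rewrite /coset_proj scaler_suml; apply: eq_bigr => i _.
  by rewrite linearZ free_scaleE hφ free_combE -coset_projM.
- exact: normΔ.1.
by rewrite -[RHS](bE j) /coset_proj scaler_suml.
Qed.

Lemma kill_finite (Δ0 : set Γ) n (θ : {linear F n -> G}) (s : seq (F n)) :
    subgroup Δ0 -> Δ0 `<=` Δ -> SDP G Δ0 -> positive θ ->
    (forall z, z \in s -> θ z = 0) ->
  exists m (φ : {linear F n -> F m}) (θ' : {linear F m -> G}),
    factors θ φ θ' /\ forall z, z \in s -> φ z = 0.
Proof.
move=> h0 sub sdp pθ; elim: s => [|z s IH] hs.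
  by exists n, idfun, θ; split; [split=> //; move=> x | ].
have [|m [φ [θ' [fφ φs]]]] := IH; first by move=> w hw; rewrite hs // inE hw orbT.
have [_ pθ' e] := fφ.
have [|k [ψ [θ'' [fψ ψz]]]] := kill_relation (z := φ z) h0 sub sdp pθ'.
  by rewrite -[LHS]/((θ' \o φ) z) e hs // inE eqxx.
exists k, (ψ \o φ)%FUN, θ''; split; first exact: factors_comp fφ fψ.
by move=> w; rewrite inE => /orP[/eqP -> // | /φs /= ->]; rewrite linear0.
Qed.

(** By noetherianity finitely many relations generate all of them. *)
Lemma kill_kernel (Δ0 : set Γ) n (θ : {linear F n -> G}) :
    left_noetherian (group_ring Γ) ->
    subgroup Δ0 -> Δ0 `<=` Δ -> SDP G Δ0 -> positive θ ->
  exists m (φ : {linear F n -> F m}) (θ' : {linear F m -> G}),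
    factors θ φ θ' /\ forall z, θ z = 0 -> φ z = 0.
Proof.
move=> noeth h0 sub sdp pθ.
have [s [sN sK]] := free_noetherian noeth (kernel_submodule θ).
have [m [φ [θ' [fφ φs]]]] := kill_finite h0 sub sdp pθ sN.
exists m, φ, θ'; split=> // z hz.
exact: (sK _ (kernel_submodule φ) φs z hz).
Qed.

(** * Amalgamating positive maps *)

Lemma sum_maps n m (θ : {linear F n -> G}) (η : {linear F m -> G}) :
    positive θ -> positive η ->
  exists (ι : {linear F n -> F (n + m)}) (κ : {linear F m -> F (n + m)})
      (ζ : {linear F (n + m) -> G}),
    [/\ factors θ ι ζ, factors η κ ζ &
      forall i, (exists j, free_basis Δ i = ι (free_basis Δ j)) \/
                (exists j, free_basis Δ i = κ (free_basis Δ j))].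
Proof.
move=> pθ pη.
have [ι hι] := free_mapF (fun i : 'I_n => free_basis Δ (lshift m i)).
have [κ hκ] := free_mapF (fun i : 'I_m => free_basis Δ (rshift n i)).
have [ζ hζ] := free_mapG (fun k => match split k with
  inl i => θ (free_basis Δ i) | inr j => η (free_basis Δ j) end).
have pι : positive ι by apply: free_positive => i; rewrite hι free_basis_ge0.
have pκ : positive κ by apply: free_positive => i; rewrite hκ free_basis_ge0.
have pζ : positive ζ.
  apply: free_positive => k; rewrite hζ.
  by case: split => i; [apply: pθ | apply: pη]; apply: free_basis_ge0.
exists ι, κ, ζ; split; first split=> //.
- apply: (@free_ext _ _ _ _ (ζ \o ι)%FUN) => i /=; rewrite hι hζ.
  by rewrite -[lshift m i]/(unsplit (inl i)) unsplitK.
- split=> //; apply: (@free_ext _ _ _ _ (ζ \o κ)%FUN) => i /=; rewrite hκ hζ.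
  by rewrite -[rshift n i]/(unsplit (inr i)) unsplitK.
move=> k; rewrite -(splitK k).
by case: split => i; [left | right]; exists i; rewrite ?hι ?hκ.
Qed.

(** Elements with positive image are made positive together with the
    relations: adjoining a generator above each [θ(f)] turns the difference
    between [f] and this generator into a relation. *)
Lemma kill_kernel_positive (Δ0 : set Γ) n (θ : {linear F n -> G})
    (k : nat) (f : 'I_k -> F n) :
    left_noetherian (group_ring Γ) ->
    subgroup Δ0 -> Δ0 `<=` Δ -> SDP G Δ0 -> positive θ ->
    (forall t, 0 <= θ (f t)) ->
  exists m (φ : {linear F n -> F m}) (θ' : {linear F m -> G}),
    [/\ factors θ φ θ', forall z, θ z = 0 -> φ z = 0 & forall t, 0 <= φ (f t)].
Proof.
move=> noeth h0 sub sdp pθ f0.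
have [η hη] := free_mapG (θ \o f).
have pη : positive η by apply: free_positive => t; rewrite hη /= f0.
have [ι [κ [ζ [fι fκ _]]]] := sum_maps pθ pη.
have [_ pζ eι] := fι; have [pκ _ eκ] := fκ.
have [m [φ [θ' [fφ kerφ]]]] := kill_kernel noeth h0 sub sdp pζ.
have [pφ _ _] := fφ.
exists m, (φ \o ι)%FUN, θ'; split; first exact: factors_comp fι fφ.
  by move=> z hz /=; apply: kerφ; rewrite -[LHS]/((ζ \o ι) z) eι.
move=> t /=; have -> : φ (ι (f t)) = φ (κ (free_basis Δ t)).
  apply/eqP; rewrite -subr_eq0 -linearB; apply/eqP/kerφ; rewrite linearB.
  rewrite -[X in X - _]/((ζ \o ι) _) -[X in _ - X]/((ζ \o κ) _) eι eκ hη.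
  exact: subrr.
by apply/pφ/pκ/free_basis_ge0.
Qed.

(** * Discarding coordinates *)

(** Keep the coordinates at which [v] is nonzero. An element between zero and a
    multiple of [v] vanishes at all the others, so that it is recovered from
    its restriction by extension by zero. *)
Lemma restrict_support n (v : F n) : 0 <= v ->
  exists r (ρ : {linear F n -> F r}) (σ : {linear F r -> F n}),
    [/\ positive ρ, positive σ, forall k, ρ v k != 0 &
      forall a y, 0 <= y -> y <= a *: v -> σ (ρ y) = y].
Proof.
move=> v0; pose S := [set k | v k != 0]%SET.
pose e (k : 'I_#|S|) : 'I_n := enum_val k.
have [σ hσ] := free_mapF (fun k => free_basis Δ (e k)).
pose f (y : F n) : F #|S| := [ffun k => y (e k)].
have fL : linear f by move=> a x y; apply/ffunP => k; rewrite !ffunE.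
pose ρ : {linear F n -> F #|S|} :=
  HB.pack f (GRing.isLinear.Build _ _ _ _ f fL).
have σE y j : σ y j = \sum_k (if e k == j then y k else 0).
  rewrite [in LHS](free_combK y) linear_sum sum_ffunE; apply: eq_bigr => k _.
  rewrite linearZ free_scaleE hσ ffunE.
  by case: ifP; rewrite ?scaler0 // -coset_projM mulr1 coset_liftK.
exists #|S|, ρ, σ; split.
- by move=> y /free_ge0P hy; apply/free_ge0P => k; rewrite ffunE.
- by apply: free_positive => k; rewrite hσ free_basis_ge0.
- by move=> k; rewrite ffunE; have := enum_valP k; rewrite inE.
move=> a y y0 yv; apply/ffunP => j; rewrite σE.
have [jS | jS] := boolP (j \in S).
  rewrite (bigD1 (enum_rank_in jS j)) //= big1 ?addr0 => [|k kj].
    by rewrite /e enum_rankK_in // eqxx ffunE /e enum_rankK_in.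
  case: eqP => // ekj; case/eqP: kj; apply: enum_val_inj.
  by rewrite enum_rankK_in.
rewrite big1 => [|k _]; last first.
  by case: eqP => // ekj; have := enum_valP k; rewrite -/(e k) ekj (negPf jS).
have vj : v j = 0 by apply/eqP; move: jS; rewrite inE negbK.
move: y0 yv => /free_ge0P/(_ j) y0 /free_leP/(_ j).
rewrite free_scaleE vj scaler0 sub0r => yj.
apply/malgP => C; have := y0 C; have := yj C; rewrite mcoeffN mcoeff0 oppr_ge0.
by move=> h1 h2; apply/le_anti; rewrite h1 h2.
Qed.

End Factorizations.

(** * Order units of free modules *)

Section OrderUnits.
Context (Γ : groupType) (Δ : set Γ) (n : nat).
Local Notation F := (free_module Δ n).

(** Some coset has a positive integer coefficient in the coordinate [v i], and a
    representative of it will do. *)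
Lemma free_unit_basis (v : F) : 0 <= v -> (forall k, v k != 0) ->
  forall i, exists γ, gelt γ *: free_basis Δ i <= v.
Proof.
move=> /free_ge0P v0 vN i.
have [C vC] : exists C, (v i)@_C != 0.
  apply: contrapT => h; move/eqP: (vN i); apply; apply/malgP => C.
  rewrite mcoeff0; apply/eqP; apply: contrapT => /negP hC.
  by apply: h; exists C.
exists (coset_rep C); apply/free_leP => j; rewrite free_scaleE ffunE.
case: eqP => [<- | _]; last by rewrite scaler0 subr0; apply: v0.
have -> : gelt (coset_rep C) *: coset_proj Δ 1 = << C >>.
  by rewrite -coset_projM mulr1 coset_projU coset_repK.
move=> C'; rewrite mcoeffB mcoeffU subr_ge0.
case: eqP => [<- | _]; last exact: v0.
by rewrite -gtz0_ge1 lt_def vC v0.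
Qed.

Lemma free_ge0_comb (x : F) : 0 <= x -> exists2 a : 'I_n -> group_ring Γ,
  forall i, malg_ge0 Γ (a i) & x = \sum_i a i *: free_basis Δ i.
Proof.
move=> /free_ge0P h; exists (fun i => coset_lift (x i)).
  by move=> i; apply: coset_lift_ge0.
exact: free_combK.
Qed.

Lemma malg_ge0M (a b : group_ring Γ) :
  malg_ge0 Γ a -> malg_ge0 Γ b -> malg_ge0 Γ (a * b).
Proof. exact: zact_ge0. Qed.

Lemma free_order_unit (v : F) :
  0 <= v -> (forall k, v k != 0) -> order_unit v.
Proof.
move=> v0 vN; split=> // x.
have [y [xy y0]] := free_directed x 0.
have [a a0 ya] := free_ge0_comb y0.
have [γ γv] := boolp.choice (free_unit_basis v0 vN).
pose b : group_ring Γ := \sum_i a i * gelt (γ i)^-1%g.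
have b0 : malg_ge0 Γ b.
  by apply: malg_ge0_sum => i; apply: malg_ge0M => //; apply: gelt_ge0.
exists (1 + b); split.
- by apply: malg_ge0D => //; rewrite -gelt1; apply: gelt_ge0.
- apply/eqP => /malgP /(_ 1%g); rewrite mcoeffD mcoeff0 -gelt1 /gelt mcoeffUU.
  by apply/eqP; rewrite gt_eqF // ltr_wpDr.
apply: le_trans xy _; rewrite scalerDl scale1r -[y]add0r; apply: og_lerD => //.
rewrite ya /b scaler_suml -og_subr_ge0 -sumrB; apply: og_sumr_ge0 => i.
rewrite -scalerA -scalerBr; apply: og_scale_ge0 => //; rewrite og_subr_ge0.
by rewrite -[X in X <= _]gelt_scale1 -(mulVg (γ i)) gelt_scaleM og_leZ.
Qed.

Lemma free_generating_interval (v : F) : 0 <= v -> (forall k, v k != 0) ->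
  generating_interval [set z | 0 <= z /\ z <= v].
Proof.
move=> v0 vN; split.
- by move=> x [].
- by [].
- by move=> x y [x0 xv] [y0 yv]; exists v.
- by move=> x y z [x0 _] [_ yv] xz zy; split; [apply: le_trans xz | apply: le_trans yv].
move=> x x0; have [a a0 xa] := free_ge0_comb x0.
have [γ γv] := boolp.choice (free_unit_basis v0 vN).
exists n, (fun i => a i * gelt (γ i)^-1%g), (fun i => gelt (γ i) *: free_basis Δ i).
split.
  move=> i; split; first by apply: malg_ge0M => //; apply: gelt_ge0.
  split=> //; apply: og_scale_ge0; first exact: gelt_ge0.
  exact: free_basis_ge0.
rewrite xa; apply: eq_bigr => i _.
by rewrite -scalerA -gelt_scaleM mulVg gelt_scale1.
Qed.

End OrderUnits.

(** * Stages and their transitions *)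

Section Stages.
Context (Γ : groupType) (Δ : set Γ) (G : ogroupType Γ) (D : set G).
Local Notation F := (free_module Δ).

(** A finite approximation of [G] together with the section on which it is
    faithful. The sections that arise are images of maps that have killed
    their kernels over [G]. The rank makes the order of stages strict, so that
    the identity is the only transition from a stage to itself. *)
Record stage := Stage {
  stage_rank : nat;
  stage_dim : nat;
  realize : {linear F stage_dim -> G};
  stage_unit : F stage_dim;
  stage_section : set (F stage_dim);
  realize_ge0 : positive realize;
  unit_ge0 : 0 <= stage_unit;
  unit_neq0 : forall k, stage_unit k != 0;
  unit_interval : D (realize stage_unit);
  unit_section : stage_section stage_unit;
  section_inj : forall x y, stage_section x -> stage_section y ->
    realize x = realize y -> x = y
}.
Local Notation car i := (F (stage_dim i)).

HB.instance Definition _ := gen_eqMixin stage.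
HB.instance Definition _ := gen_choiceMixin stage.
Implicit Types i j k : stage.

Definition advance i j (φ : car i -> car j) :=
  [/\ (stage_rank i < stage_rank j)%N, linear φ /\ positive φ,
    forall x, realize j (φ x) = realize i x,
    forall x, stage_section (φ x) & φ (stage_unit i) <= stage_unit j].

Definition transition i j (φ : car i -> car j) :=
  (exists e : i = j, φ = ecast l (car i -> car l) e idfun) \/ advance φ.

Lemma transition_id i : transition (@idfun (car i)).
Proof. by left; exists erefl. Qed.

Lemma transition_comp i j k (φ : car i -> car j) (ψ : car j -> car k) :
  transition φ -> transition ψ -> transition (ψ \o φ).
Proof.
move=> [[e ->] | hφ]; first by case: _ / e ψ.
move=> [[e ->] | hψ]; right; first by case: _ / e.
case: hφ hψ => rφ [lφ pφ] eφ sφ uφ [rψ [lψ pψ] eψ sψ uψ]; split=> /=.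
- exact: ltn_trans rψ.
- by split; [move=> a x y /=; rewrite lφ lψ | exact: positive_comp].
- by move=> x; rewrite eψ eφ.
- by move=> x; apply: sψ.
apply: le_trans uψ.
pose ψl : {linear car j -> car k} :=
  HB.pack ψ (GRing.isLinear.Build _ _ _ _ ψ lψ).
exact: (@positive_le _ _ _ ψl).
Qed.

(** On the target section an element is determined by its image in [G], hence
    so is a map over [G] which lands there. *)
Lemma transition_unique i j (φ ψ : car i -> car j) :
  transition φ -> transition ψ -> φ = ψ.
Proof.
move=> [[e ->] | hφ] [[e' ->] | hψ].
- by rewrite (Prop_irrelevance e e').
- by exfalso; case: hψ => + _ _ _ _; rewrite e ltnn.
- by exfalso; case: hφ => + _ _ _ _; rewrite e' ltnn.
case: hφ hψ => _ _ eφ sφ _ [_ _ eψ sψ _]; apply/funext => x.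
by apply: (section_inj (sφ x) (sψ x)); rewrite eφ eψ.
Qed.

Definition stage_le i j := `[< exists φ : car i -> car j, transition φ >].

Lemma stage_le_refl : reflexive stage_le.
Proof. by move=> i; apply/asboolP; exists idfun; apply: transition_id. Qed.

Lemma stage_le_trans : transitive stage_le.
Proof.
move=> j i k /asboolP[φ hφ] /asboolP[ψ hψ]; apply/asboolP.
by exists (ψ \o φ); apply: transition_comp.
Qed.

HB.instance Definition _ :=
  Order.Le_isPreorder.Build (Order.Disp tt tt) stage
    stage_le_refl stage_le_trans.

Definition stage_map i j (h : (i <= j)%O) : car i -> car j :=
  sval (cid (asboolP _ h)).

Lemma stage_mapP i j (h : (i <= j)%O) : transition (stage_map h).
Proof. by rewrite /stage_map; case: cid. Qed.

Lemma advance_le i j (φ : car i -> car j) : advance φ -> (i <= j)%O.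
Proof. by move=> hφ; apply/asboolP; exists φ; right. Qed.

Lemma advance_stage_map i j (φ : car i -> car j) (h : (i <= j)%O) :
  advance φ -> stage_map h = φ.
Proof. by move=> hφ; apply: transition_unique; [apply: stage_mapP | right]. Qed.

Lemma stage_map1 i (h : (i <= i)%O) : stage_map h = idfun.
Proof. exact: transition_unique (stage_mapP h) (transition_id i). Qed.

Lemma stage_mapM i j k (hij : (i <= j)%O) (hjk : (j <= k)%O) (hik : (i <= k)%O) :
  stage_map hjk \o stage_map hij = stage_map hik.
Proof.
apply: transition_unique (stage_mapP hik).
exact: transition_comp (stage_mapP hij) (stage_mapP hjk).
Qed.

Section StageMap.
Context i j (h : (i <= j)%O).

Lemma stage_map_linear : linear (stage_map h).
Proof. by case: (stage_mapP h) => [[e ->] | [_ [? _] _ _ _] //]; case: _ / e. Qed.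

HB.instance Definition _ :=
  GRing.isLinear.Build _ _ _ _ (stage_map h) stage_map_linear.

Lemma stage_map_ge0 : positive (stage_map h).
Proof. by case: (stage_mapP h) => [[e ->] | [_ [_ ?] _ _ _] //]; case: _ / e. Qed.

Lemma stage_map_realize x : realize j (stage_map h x) = realize i x.
Proof. by case: (stage_mapP h) => [[e ->] | [_ _ + _ _] //]; case: _ / e. Qed.

Lemma stage_map_unit_le : stage_map h (stage_unit i) <= stage_unit j.
Proof. by case: (stage_mapP h) => [[e ->] | [_ _ _ _ ?] //]; case: _ / e. Qed.

Lemma stage_map_unit : realize i (stage_unit i) = realize j (stage_unit j) ->
  stage_map h (stage_unit i) = stage_unit j.
Proof.
case: (stage_mapP h) => [[e ->] | [_ _ e s _] u]; first by case: _ / e.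
by apply: (section_inj (s _) (unit_section j)); rewrite e.
Qed.

End StageMap.

End Stages.
Arguments realize_ge0 {Γ Δ G D} s.
Arguments unit_neq0 {Γ Δ G D} s.

(** * The directed system of stages *)

Section Domination.
Context (Γ : groupType) (G : ogroupType Γ).
Implicit Types x y z : G.

Definition dominated (x y : G) := exists2 a : group_ring Γ, malg_ge0 Γ a & x <= a *: y.

Lemma dominated_trans x y z : dominated x y -> dominated y z -> dominated x z.
Proof.
move=> [a a0 xy] [b b0 yz]; exists (a * b); first exact: malg_ge0M.
by apply: le_trans xy _; rewrite -scalerA; apply: og_ler_scale.
Qed.

Lemma dominated_le (x y : G) : x <= y -> dominated x y.
Proof.
move=> xy; exists 1; last by rewrite scale1r.
by rewrite -gelt1; apply: gelt_ge0.
Qed.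

End Domination.

(** The common ground of order units, with [D = [set u]], and of generating
    intervals. *)
Definition exhausting (Γ : groupType) (G : ogroupType Γ) (D : set G) :=
  [/\ exists d, D d, forall d, D d -> 0 <= d,
      forall d e, D d -> D e -> exists f, [/\ D f, d <= f & e <= f]
    & forall x, 0 <= x -> exists2 d, D d & dominated x d].

Section StageSystem.
Context (Γ : groupType) (Δ0 Δ : set Γ) (G : ogroupType Γ) (D : set G).
Local Notation F := (free_module Δ).
Local Notation stage := (stage Δ D).
Implicit Types i j k : stage.
Local Notation car i := (F (stage_dim i)).

Context (noeth : left_noetherian (group_ring Γ))
  (h0 : subgroup Δ0) (sub : Δ0 `<=` Δ) (normΔ : normal_subgroup Δ)
  (stabΔ : Δ `<=` Stab G) (sdp : SDP G Δ0) (dirG : directed G)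
  (exhD : exhausting D).

Lemma stage_dominated i x : dominated (realize i x) (realize i (stage_unit i)).
Proof.
have [_ /(_ x) [a [a0 _ xa]]] := free_order_unit (unit_ge0 i) (unit_neq0 i).
by exists a => //; rewrite -linearZ; apply: positive_le => //; apply: realize_ge0.
Qed.

(** Kill the kernel of [θ], and make [v] dominate the generators not only in [G]
    but in the free module. The coordinates at which the image of [v] vanishes
    then carry nothing and can be discarded, after which it is an order unit;
    the image of the resulting map is the section. *)
Lemma stage_exists (r n m : nat) (θ : {linear F n -> G}) (v : F n)
    (f : 'I_m -> F n) :
    positive θ -> 0 <= v -> D (θ v) ->
    (forall l, dominated (θ (free_basis Δ l)) (θ v)) ->
    (forall t, 0 <= θ (f t)) ->
  exists i (φ : {linear F n -> car i}),
    [/\ stage_rank i = r, positive φ /\ (forall x, realize i (φ x) = θ x),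
      φ v = stage_unit i, forall x, stage_section (φ x) & forall t, 0 <= φ (f t)].
Proof.
move=> pθ v0 Dv dom f0.
have [a a0 va] : exists2 a : 'I_n -> group_ring Γ, forall l, malg_ge0 Γ (a l) &
    forall l, θ (free_basis Δ l) <= a l *: θ v.
  have h l : exists a : group_ring Γ, malg_ge0 Γ a /\ θ (free_basis Δ l) <= a *: θ v.
    by have [a] := dom l; exists a.
  by have [a ha] := boolp.choice h; exists a => l; case: (ha l).
(* The second half of this family expresses that [v] dominates the generators. *)
pose g (t : 'I_(m + n)) := match split t with
  inl t => f t | inr l => a l *: v - free_basis Δ l end.
have g0 t : 0 <= θ (g t).
  by rewrite /g; case: split => // l; rewrite linearB linearZ og_subr_ge0.
have [q [φ [θ' [[pφ pθ' eθ] kerφ φg]]]] :=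
  kill_kernel_positive normΔ stabΔ noeth h0 sub sdp pθ g0.
have φv0 : 0 <= φ v by apply: pφ.
have [s [ρ [σ [pρ pσ ρN σρ]]]] := restrict_support normΔ φv0.
have σρφ x : σ (ρ (φ x)) = φ x.
  apply: (@free_ext _ _ _ _ (σ \o (ρ \o φ))%FUN) => l /=.
  apply: (σρ (a l)); first by apply/pφ/free_basis_ge0.
  have := φg (rshift m l); rewrite /g -[rshift m l]/(unsplit (inr l)) unsplitK.
  by rewrite linearB linearZ og_subr_ge0.
have eθρ x : θ' (σ (ρ (φ x))) = θ x by rewrite σρφ -eθ.
have inj x y : range (ρ \o φ) x -> range (ρ \o φ) y ->
    (θ' \o σ) x = (θ' \o σ) y -> x = y.
  move=> [x' _ <-] [y' _ <-] /=; rewrite !eθρ => e; congr (ρ _).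
  apply/eqP; rewrite -subr_eq0 -linearB; apply/eqP/kerφ.
  by rewrite linearB e subrr.
have Dρv : D ((θ' \o σ)%FUN (ρ (φ v))) by rewrite /= eθρ.
have Sρv : range (ρ \o φ) (ρ (φ v)) by exists v.
exists (@Stage _ _ _ D r s (θ' \o σ)%FUN (ρ (φ v)) (range (ρ \o φ))
  (positive_comp pσ pθ') (pρ _ φv0) ρN Dρv Sρv inj), (ρ \o φ)%FUN; split=> //=.
- by split; [exact: positive_comp | exact: eθρ].
- by move=> x; exists x.
move=> t; have := φg (lshift n t).
by rewrite /g -[lshift n t]/(unsplit (inl t)) unsplitK => /pρ.
Qed.

Let Dge0 d : D d -> 0 <= d.
Proof. by have [_ h _ _] := exhD; apply: h. Qed.

Let free_mapG n (x : 'I_n -> G) :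
  exists f : {linear F n -> G}, forall l, f (free_basis Δ l) = x l.
Proof. by apply: free_map; [exact: normΔ.1 | move=> δ y /stabΔ]. Qed.

(** The two generators of a free module of rank two are sent to [d] and [x], and
    the first one serves as the unit. *)
Lemma stage_cover d x : D d -> 0 <= x -> dominated x d ->
  exists i y, [/\ realize i (stage_unit i) = d, 0 <= y & realize i y = x].
Proof.
move=> Dd x0 xd.
have [θ hθ] := free_mapG (fun l : 'I_2 => if l == ord0 then d else x).
have pθ : positive θ.
  by apply: free_positive => l; rewrite hθ; case: eqP => // _; apply: Dge0.
have [|||i [φ [_ [pφ eφ] φu _ _]]] := @stage_exists 0 _ 0 θ
  (free_basis Δ ord0) (fun=> 0) pθ (free_basis_ge0 _ _).
- by rewrite hθ.
- move=> l; rewrite !hθ eqxx; case: ifP => // _; exact: dominated_le.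
- by move=> t; rewrite linear0.
exists i, (φ (free_basis Δ ord_max)); split.
- by rewrite -φu eφ hθ.
- by apply/pφ/free_basis_ge0.
- by rewrite eφ hθ.
Qed.

(** The sum of the two stages is extended by one more generator, sent to an
    upper bound in [D] of the images of both units; this generator becomes the
    new unit. That it exceeds the old units holds in [G], hence can be forced
    in the free module. *)
Lemma stage_advance i j : exists k (φ : car i -> car k) (ψ : car j -> car k),
  advance φ /\ advance ψ.
Proof.
have [_ _ Ddir _] := exhD.
have [d [Dd di dj]] := Ddir _ _ (unit_interval i) (unit_interval j).
have [η hη] := free_mapG (fun _ : 'I_1 => d).
have pη : positive η by apply: free_positive => l; rewrite hη; apply: Dge0.
have [ι [κ [ζ [[pι pζ eι] [pκ _ eκ] gen1]]]] :=
  sum_maps normΔ stabΔ (realize_ge0 i) (realize_ge0 j).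
have [ι' [κ' [ξ [[pι' pξ eι'] [pκ' _ eκ'] gen2]]]] :=
  sum_maps normΔ stabΔ pζ pη.
pose v := κ' (free_basis Δ ord0).
have ξv : ξ v = d by rewrite -[LHS]/((ξ \o κ') _) eκ' hη.
have ξi x : ξ (ι' (ι x)) = realize i x.
  by rewrite -[LHS]/((ξ \o ι') _) eι' -[LHS]/((ζ \o ι) _) eι.
have ξj x : ξ (ι' (κ x)) = realize j x.
  by rewrite -[LHS]/((ξ \o ι') _) eι' -[LHS]/((ζ \o κ) _) eκ.
pose f (t : 'I_2) := if t == ord0 then v - ι' (ι (stage_unit i))
  else v - ι' (κ (stage_unit j)).
have [||||k [φ [rk [pφ eφ] φv sφ φf]]] :=
  @stage_exists (maxn (stage_rank i) (stage_rank j)).+1 _ _ ξ v f pξ.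
- by apply/pκ'/free_basis_ge0.
- by rewrite ξv.
- rewrite ξv => l; case: (gen2 l) => [[l' ->] | [l' ->]]; last first.
    by rewrite -[X in dominated X]/((ξ \o κ') _) eκ' hη; apply: dominated_le.
  case: (gen1 l') => [[t ->] | [t ->]]; rewrite ?ξi ?ξj.
    exact: (dominated_trans (stage_dominated _) (dominated_le di)).
  exact: (dominated_trans (stage_dominated _) (dominated_le dj)).
- by move=> t; rewrite /f; case: eqP => _;
    rewrite linearB ξv ?ξi ?ξj og_subr_ge0.
exists k, (φ \o (ι' \o ι))%FUN, (φ \o (ι' \o κ))%FUN.
split; split=> /=.
- by rewrite rk ltnS leq_maxl.
- split; first exact: linearP.
  by apply: positive_comp pφ; apply: positive_comp.
- by move=> x; rewrite eφ ξi.
- by move=> x; apply: sφ.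
- by have := φf ord0; rewrite /f eqxx linearB φv og_subr_ge0.
- by rewrite rk ltnS leq_maxr.
- split; first exact: linearP.
  by apply: positive_comp pφ; apply: positive_comp.
- by move=> x; rewrite eφ ξj.
- by move=> x; apply: sφ.
- by have := φf ord_max; rewrite /f /= linearB φv og_subr_ge0.
Qed.

Lemma stage_inhabited : inhabited stage.
Proof.
have [[d Dd] _ _ _] := exhD.
have [i _] := stage_cover Dd (Dge0 Dd) (dominated_le (lexx d)).
exact: inhabits.
Qed.

Lemma stage_unit_surj d : D d -> exists i, realize i (stage_unit i) = d.
Proof.
move=> Dd.
by have [i [_ [id _ _]]] := stage_cover Dd (Dge0 Dd) (dominated_le (lexx d)); exists i.
Qed.

Lemma stage_directed : directed stage.
Proof.
move=> i j; have [k [φ [ψ [hφ hψ]]]] := stage_advance i j.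
by exists k; split; [exact: advance_le hφ | exact: advance_le hψ].
Qed.

Lemma realize_ge0_surj x : 0 <= x -> exists i y, 0 <= y /\ realize i y = x.
Proof.
move=> x0; have [_ _ _ /(_ x x0) [d Dd xd]] := exhD.
have [i [y [_ y0 yx]]] := stage_cover Dd x0 xd.
by exists i, y.
Qed.

Lemma realize_surj x : exists i y, realize i y = x.
Proof.
have [z [xz z0]] := dirG x 0.
have [i [y [_ yz]]] := realize_ge0_surj z0.
have [|j [t [_ tx]]] := @realize_ge0_surj (z - x); first by rewrite og_subr_ge0.
have [k [ik jk]] := stage_directed i j.
exists k, (stage_map ik y - stage_map jk t).
by rewrite linearB !stage_map_realize yz tx subKr.
Qed.

(** Any transition that raises the rank lands in a section, so it identifies
    all elements with the same image in [G]. *)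
Lemma realize_inj i (x y : car i) : realize i x = realize i y ->
  exists j (h : (i <= j)%O), stage_map h x = stage_map h y.
Proof.
move=> e; have [j [φ [_ [hφ _]]]] := stage_advance i i.
exists j, (advance_le hφ); rewrite (advance_stage_map _ hφ).
by case: hφ => _ _ eφ sφ _; apply: (section_inj (sφ x) (sφ y)); rewrite !eφ.
Qed.

End StageSystem.

(** * Direct limits in categories of structured sets *)

Section Isomorphisms.
Context (C D : category).

Lemma is_iso_idc (X : C) : is_iso (idc X).
Proof. by exists (idc X); rewrite ccomp1f. Qed.

Lemma is_iso_fmap (F : functor C D) (X Y : C) (f : hom X Y) :
  is_iso f -> is_iso (fmap F f).
Proof. by move=> [g [fg gf]]; exists (fmap F g); rewrite -!fmapM fg gf !fmap1. Qed.

End Isomorphisms.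

Section ConcreteLimits.
Context (T : Type) (car : T -> Type).
Context (P : forall X Y : T, (car X -> car Y) -> Prop).
Context (P1 : forall X : T, P (X := X) (Y := X) idfun).
Context (PM : forall (X Y Z : T) (f : car X -> car Y) (g : car Y -> car Z),
  P f -> P g -> P (g \o f)).
Local Notation C := (concrete P1 PM).

(** On underlying sets the induced map exists and is unique as soon as the
    legs are jointly surjective and identify only what the system
    eventually identifies; it remains to see that it is a morphism. *)
Lemma concrete_limit (S : directed_system C) (c : cocone S) :
    (forall x : car (apex c), exists i y, sval (leg c i) y = x) ->
    (forall i x y, sval (leg c i) x = sval (leg c i) y ->
       exists j (h : (i <= j)%O), sval (ds_map h) x = sval (ds_map h) y) ->
    (forall (c' : cocone S) (h : car (apex c) -> car (apex c')),
       (forall i y, h (sval (leg c i) y) = sval (leg c' i) y) -> P h) ->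
  is_direct_limit c.
Proof.
move=> surj inj morph c'.
have legE (d : cocone S) i j (h : (i <= j)%O) y :
    sval (leg d j) (sval (ds_map h) y) = sval (leg d i) y.
  by rewrite -[in RHS](legM d h).
have wd i j x y : sval (leg c i) x = sval (leg c j) y ->
    sval (leg c' i) x = sval (leg c' j) y.
  move=> e; have [k [ik jk]] := ds_directed i j.
  have [|l [kl exy]] := inj k (sval (ds_map ik) x) (sval (ds_map jk) y).
    by rewrite !legE.
  by rewrite -(legE _ _ _ ik) -(legE _ _ _ jk) -(legE _ _ _ kl) exy legE.
have pick x : exists z, forall i y, sval (leg c i) y = x ->
    sval (leg c' i) y = z.
  have [i [y yx]] := surj x; exists (sval (leg c' i) y) => j t tx.
  by apply: wd; rewrite tx yx.
have [h hE] := boolp.choice pick.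
have hleg i y : h (sval (leg c i) y) = sval (leg c' i) y.
  by rewrite (hE _ i y erefl).
exists (exist _ h (morph c' h hleg)); split=> [i | g gE].
  by apply: chom_eq; apply/funext => y; apply: hleg.
apply: chom_eq; apply/funext => x /=; have [i [y <-]] := surj x.
by rewrite hleg -gE.
Qed.

Section Presentation.
Context (d : Order.disp_t) (I : preorderType d).
Context (I0 : inhabited I) (Idir : directed I) (X : I -> T) (Y : T).
Context (f : forall i j : I, (i <= j)%O -> car (X i) -> car (X j)).
Context (g : forall i : I, car (X i) -> car Y).
Context (fP : forall (i j : I) (h : (i <= j)%O), P (f h)).
Context (gP : forall i : I, P (@g i)).
Context (f1 : forall (i : I) (h : (i <= i)%O), f h = idfun).
Context (fM : forall (i j k : I)
  (hij : (i <= j)%O) (hjk : (j <= k)%O) (hik : (i <= k)%O),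
  f hjk \o f hij = f hik).
Context (gM : forall (i j : I) (h : (i <= j)%O), @g j \o f h = @g i).

Let fhom i j (h : (i <= j)%O) : hom (X i : C) (X j) := exist _ (f h) (fP h).

Let fhom1 i (h : (i <= i)%O) : fhom h = idc (X i : C).
Proof. by apply: chom_eq; apply: f1. Qed.

Let fhomM (i j k : I)
    (hij : (i <= j)%O) (hjk : (j <= k)%O) (hik : (i <= k)%O) :
  ccomp (fhom hij) (fhom hjk) = fhom hik.
Proof. by apply: chom_eq; apply: fM. Qed.

Definition concrete_system : directed_system C :=
  DirectedSystem (C := C) I0 Idir fhom1 fhomM.

Let ghom i : hom (concrete_system i) (Y : C) := exist _ (@g i) (gP i).

Let ghomM (i j : I) (h : (i <= j)%O) :
  ccomp (@ds_map _ concrete_system i j h) (ghom j) = ghom i.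
Proof. by apply: chom_eq; apply: gM. Qed.

Definition concrete_presentation : presentation (Y : C) :=
  Presentation (C := C) (pr_cocone := Cocone (S := concrete_system) ghomM)
    (idc (Y : C)).

End Presentation.

End ConcreteLimits.

(** * Maps induced on the limit *)

Section StagePresentations.
Context (Γ : groupType) (Δ0 Δ : set Γ) (G : ogroupType Γ) (D : set G).
Local Notation F := (free_module Δ).
Local Notation stage := (stage Δ D).
Implicit Types i j k : stage.
Local Notation car i := (F (stage_dim i)).

Context (noeth : left_noetherian (group_ring Γ))
  (h0 : subgroup Δ0) (sub : Δ0 `<=` Δ) (normΔ : normal_subgroup Δ)
  (stabΔ : Δ `<=` Stab G) (sdp : SDP G Δ0) (dirG : directed G)
  (exhD : exhausting D).

Let inhab := stage_inhabited noeth h0 sub normΔ stabΔ sdp exhD.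
Let dir := stage_directed noeth h0 sub normΔ stabΔ sdp exhD.
Let surj := realize_surj noeth h0 sub normΔ stabΔ sdp dirG exhD.
Let surj_ge0 := realize_ge0_surj noeth h0 sub normΔ stabΔ sdp exhD.
Let surjD := stage_unit_surj noeth h0 sub normΔ stabΔ sdp exhD.
Let inj := realize_inj noeth h0 sub normΔ stabΔ sdp exhD.

Lemma realize_og_mor i : og_mor (realize i).
Proof. by split; [exact: linearP | exact: realize_ge0]. Qed.

Lemma stage_map_og_mor i j (h : (i <= j)%O) : og_mor (stage_map h).
Proof. by split; [exact: stage_map_linear | exact: stage_map_ge0]. Qed.

Lemma stage_map_realizeE i j (h : (i <= j)%O) :
  realize j \o stage_map h = realize i.
Proof. by apply/funext => x; apply: stage_map_realize. Qed.

(** Finitely many elements of [G] come from one stage, where the legs of the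
    cocone are linear; positive elements come from positive elements. *)
Lemma induced_og_mor (H : ogroupType Γ) (h : G -> H) (l : forall i, car i -> H) :
  (forall i, og_mor (@l i)) -> (forall i y, h (realize i y) = l i y) -> og_mor h.
Proof.
move=> lP hl; split=> [a x y | x x0].
  have [i [x' <-]] := surj x; have [j [y' <-]] := surj y.
  have [k [ik jk]] := dir i j.
  rewrite -(stage_map_realize ik) -(stage_map_realize jk) -linearP !hl.
  by rewrite (lP k).1.
by have [i [y [y0 <-]]] := surj_ge0 x0; rewrite hl; apply: (lP i).2.
Qed.

(** The involutions of the stages are trivial, so that the legs of a cocone take
    values fixed by the involution of its apex. *)
Lemma star_fixed (H : ogroupType Γ) (s : H -> H) (h : G -> H)
    (l : forall i, car i -> H) :
    (forall i y, l i y = s (l i y)) -> (forall i y, h (realize i y) = l i y) ->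
  forall x, h x = s (h x).
Proof. by move=> ls hl x; have [i [y <-]] := surj x; rewrite hl -ls. Qed.

Lemma stage_simplicial i : simplicial_group (car i) Δ.
Proof. by apply: free_simplicial; case: normΔ. Qed.

(** * Presentations without distinguished elements *)

Definition star_stage i : ogroup_s Γ := trivial_s (car i : ogroupType Γ).

Lemma star_stage_mapP i j (h : (i <= j)%O) :
  ogs_mor (X := star_stage i) (Y := star_stage j) (stage_map h).
Proof. by split; first exact: stage_map_og_mor. Qed.

Lemma star_realizeP i :
  ogs_mor (X := star_stage i) (Y := trivial_s G) (realize i).
Proof. by split; first exact: realize_og_mor. Qed.

Definition star_presentation : presentation (C := OGs Γ) (trivial_s G) :=
  concrete_presentation (@ogs_mor_id Γ) (@ogs_mor_comp Γ) inhab dir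
    (X := star_stage) (Y := trivial_s G)
    star_stage_mapP star_realizeP (@stage_map1 _ _ _ _) (@stage_mapM _ _ _ _)
    stage_map_realizeE.

Lemma star_presentationP :
  iso_direct_limit star_presentation /\
  simplicial_limit Δ (image_presentation (OGs_to_OG Γ) star_presentation).
Proof.
split; [split | split; last split]; try exact: is_iso_idc.
- apply: concrete_limit => [x | i x y | c' h hl]; [exact: surj | exact: inj |].
  split.
    exact: (induced_og_mor (fun i => (svalP (leg c' i)).1) hl).
  apply: star_fixed hl => i y; exact: (svalP (leg c' i)).2.
- exact: stage_simplicial.
- apply: concrete_limit => [x | i x y | c' h hl]; [exact: surj | exact: inj |].
  exact: (induced_og_mor (fun i => svalP (leg c' i)) hl).
- exact/is_iso_fmap/is_iso_idc.
Qed.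

(** * Presentations with order units *)

Section Unit.
Context (u : G) (hu : order_unit u) (Du : D `<=` [set u]).

Lemma realize_unit i : realize i (stage_unit i) = u.
Proof. exact: (Du (unit_interval i)). Qed.

Definition unit_stage i : ogroup_us Γ :=
  trivial_us (OGroupU (free_order_unit (unit_ge0 i) (unit_neq0 i))).

Lemma unit_stage_mapP i j (h : (i <= j)%O) :
  ogus_mor (X := unit_stage i) (Y := unit_stage j) (stage_map h).
Proof.
split=> //; split; first exact: stage_map_og_mor.
by apply: stage_map_unit; rewrite !realize_unit.
Qed.

Lemma unit_realizeP i :
  ogus_mor (X := unit_stage i) (Y := trivial_us (OGroupU hu)) (realize i).
Proof. by split=> //; split; [exact: realize_og_mor | exact: realize_unit]. Qed.

Definition unit_presentation :
    presentation (C := OGus Γ) (trivial_us (OGroupU hu)) :=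
  concrete_presentation (@ogus_mor_id Γ) (@ogus_mor_comp Γ) inhab dir
    (X := unit_stage) (Y := trivial_us (OGroupU hu))
    unit_stage_mapP unit_realizeP (@stage_map1 _ _ _ _) (@stage_mapM _ _ _ _)
    stage_map_realizeE.

Lemma unit_presentationP :
  let q := image_presentation (OGus_to_OGu Γ) unit_presentation in
  [/\ iso_direct_limit unit_presentation, iso_direct_limit q &
      simplicial_limit Δ (image_presentation (OGu_to_OG Γ) q)].
Proof.
have [i0] := inhab.
split; [split | split | split; last split].
- apply: concrete_limit => [x | i x y | c' h hl]; [exact: surj | exact: inj |].
  split; first split.
  + exact: (induced_og_mor (fun i => (svalP (leg c' i)).1.1) hl).
  + rewrite -[ogu_unit _](realize_unit i0) hl.
    exact: (svalP (leg c' i0)).1.2.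
  apply: star_fixed hl => i y; exact: (svalP (leg c' i)).2.
- exact: is_iso_idc.
- apply: concrete_limit => [x | i x y | c' h hl]; [exact: surj | exact: inj |].
  split; first exact: (induced_og_mor (fun i => (svalP (leg c' i)).1) hl).
  by rewrite -[ogu_unit _](realize_unit i0) hl; apply: (svalP (leg c' i0)).2.
- exact/is_iso_fmap/is_iso_idc.
- exact: stage_simplicial.
- apply: concrete_limit => [x | i x y | c' h hl]; [exact: surj | exact: inj |].
  exact: (induced_og_mor (fun i => svalP (leg c' i)) hl).
- exact/is_iso_fmap/is_iso_fmap/is_iso_idc.
Qed.

End Unit.

(** * Presentations with generating intervals *)

Section Interval.
Context (hD : generating_interval D).

Definition interval_stage i : ogroup_Ds Γ :=
  trivial_Ds (OGroupD (free_generating_interval (unit_ge0 i) (unit_neq0 i))).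

Lemma interval_stage_mapP i j (h : (i <= j)%O) :
  ogDs_mor (X := interval_stage i) (Y := interval_stage j) (stage_map h).
Proof.
split=> //; split; first exact: stage_map_og_mor.
move=> _ [x [x0 xu] <-]; split; first exact: stage_map_ge0.
apply: le_trans (stage_map_unit_le h).
by apply: positive_le xu; apply: stage_map_ge0.
Qed.

Lemma interval_realizeP i :
  ogDs_mor (X := interval_stage i) (Y := trivial_Ds (OGroupD hD)) (realize i).
Proof.
split=> //; split; first exact: realize_og_mor.
move=> _ [x [x0 xu] <-]; have [_ D0 _ conv _] := hD.
apply: (conv 0 (realize i (stage_unit i))) => //.
- exact: unit_interval.
- exact: realize_ge0.
by apply: positive_le xu; apply: realize_ge0.
Qed.

Definition interval_presentation :
    presentation (C := OGDs Γ) (trivial_Ds (OGroupD hD)) :=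
  concrete_presentation (@ogDs_mor_id Γ) (@ogDs_mor_comp Γ) inhab dir
    (X := interval_stage) (Y := trivial_Ds (OGroupD hD))
    interval_stage_mapP interval_realizeP
    (@stage_map1 _ _ _ _) (@stage_mapM _ _ _ _) stage_map_realizeE.

Lemma induced_interval (H : ogroupType Γ) (E : set H) (h : G -> H)
    (l : forall i, car i -> H) :
    (forall i, l i @` [set z | 0 <= z /\ z <= stage_unit i] `<=` E) ->
    (forall i y, h (realize i y) = l i y) ->
  h @` D `<=` E.
Proof.
move=> lE hl _ [d Dd <-]; have [i <-] := surjD Dd; rewrite hl.
apply: lE; exists (stage_unit i) => //; split=> //; exact: unit_ge0.
Qed.

Lemma interval_presentationP :
  let q := image_presentation (OGDs_to_OGD Γ) interval_presentation in
  [/\ iso_direct_limit interval_presentation, iso_direct_limit q &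
      simplicial_limit Δ (image_presentation (OGD_to_OG Γ) q)].
Proof.
split; [split | split | split; last split].
- apply: concrete_limit => [x | i x y | c' h hl]; [exact: surj | exact: inj |].
  split; first split.
  + exact: (induced_og_mor (fun i => (svalP (leg c' i)).1.1) hl).
  + apply: induced_interval hl => i; exact: (svalP (leg c' i)).1.2.
  apply: star_fixed hl => i y; exact: (svalP (leg c' i)).2.
- exact: is_iso_idc.
- apply: concrete_limit => [x | i x y | c' h hl]; [exact: surj | exact: inj |].
  split; first exact: (induced_og_mor (fun i => (svalP (leg c' i)).1) hl).
  by apply: induced_interval hl => i; apply: (svalP (leg c' i)).2.
- exact/is_iso_fmap/is_iso_idc.
- exact: stage_simplicial.
- apply: concrete_limit => [x | i x y | c' h hl]; [exact: surj | exact: inj |].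
  exact: (induced_og_mor (fun i => svalP (leg c' i)) hl).
- exact/is_iso_fmap/is_iso_fmap/is_iso_idc.
Qed.

End Interval.

End StagePresentations.

(** * Exhausting sets *)

Section Exhausting.
Context (Γ : groupType) (G : ogroupType Γ).

Lemma order_unit_exhausting (u : G) : order_unit u -> exhausting [set u].
Proof.
move=> [u0 hu]; split; first by exists u.
- by move=> _ ->.
- by move=> _ _ -> ->; exists u.
by move=> x _; exists u => //; have [a [a0 _ xa]] := hu x; exists a.
Qed.

Lemma generating_interval_exhausting (D : set G) :
  generating_interval D -> exhausting D.
Proof.
move=> [Dge0 D0 Ddir _ Dgen]; split=> //; first by exists 0.
move=> x /Dgen [n [a [d [had ->]]]].
have [e De de] : exists2 e, D e & forall i, d i <= e.
  have [e De de] : exists2 e, D e & forall i, i \in enum 'I_n -> d i <= e.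
    elim: (enum 'I_n) => [|i r [e De de]]; first by exists 0.
    have [f [Df dif ef]] := Ddir _ _ (had i).2 De; exists f => // j.
    rewrite inE => /orP[/eqP -> // | /de]; by move/le_trans; apply.
  by exists e => // i; apply: de; rewrite mem_enum.
exists e => //; exists (\sum_i a i); first by apply: malg_ge0_sum => i; case: (had i).
rewrite scaler_suml -og_subr_ge0 -sumrB; apply: og_sumr_ge0 => i.
by rewrite og_subr_ge0; apply: og_ler_scale => //; case: (had i).
Qed.

Lemma cone_exhausting : directed G -> exhausting [set x : G | 0 <= x].
Proof.
move=> dirG; split=> //; first by exists 0; apply: lexx.
  move=> x y /= x0 _; have [z [xz yz]] := dirG x y.
  by exists z; split=> //; apply: le_trans xz.
by move=> x x0; exists x => //; apply: dominated_le.
Qed.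

End Exhausting.

Theorem theorem5p12 (Γ : groupType) (hΓ : noetherian (group_ring Γ))
    (G : ogroupType Γ) (hG : dimension_group G)
    (Δ0 : set Γ) (hΔ0 : subgroup Δ0) (hstab : Δ0 `<=` Stab G)
    (hSDP : SDP G Δ0) :
  let Δ := normal_closure Δ0 in
  [/\ exists p : presentation (C := OG Γ) G, simplicial_limit Δ p,
      forall (u : G) (hu : order_unit u),
        exists p : presentation (C := OGu Γ) (OGroupU hu),
          iso_direct_limit p /\
          simplicial_limit Δ (image_presentation (OGu_to_OG Γ) p),
      forall (D : set G) (hD : generating_interval D),
        exists p : presentation (C := OGD Γ) (OGroupD hD),
          iso_direct_limit p /\
          simplicial_limit Δ (image_presentation (OGD_to_OG Γ) p)
    & [/\ exists p : presentation (trivial_s G),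
            iso_direct_limit p /\
            simplicial_limit Δ (image_presentation (OGs_to_OG Γ) p),
          forall (u : G) (hu : order_unit u),
            exists p : presentation (trivial_us (OGroupU hu)),
              let q := image_presentation (OGus_to_OGu Γ) p in
              [/\ iso_direct_limit p, iso_direct_limit q &
                  simplicial_limit Δ (image_presentation (OGu_to_OG Γ) q)]
        & forall (D : set G) (hD : generating_interval D),
            exists p : presentation (trivial_Ds (OGroupD hD)),
              let q := image_presentation (OGDs_to_OGD Γ) p in
              [/\ iso_direct_limit p, iso_direct_limit q &
                  simplicial_limit Δ (image_presentation (OGD_to_OG Γ) q)]]].
Proof.
move=> Δ; have [normΔ sub] : normal_subgroup Δ /\ Δ0 `<=` Δ := normal_closureP Δ0.
have stabΔ : Δ `<=` Stab G := normal_closure_min (Stab_normal G) hstab.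
have [noeth _] := hΓ; have [dirG _] := hG.
have star := star_presentationP noeth hΔ0 sub normΔ stabΔ hSDP dirG
  (cone_exhausting dirG).
have unit u hu := @unit_presentationP _ _ _ _ _ noeth hΔ0 sub normΔ stabΔ hSDP
  dirG (order_unit_exhausting hu) u hu (@subset_refl _ _).
have interval D hD := interval_presentationP noeth hΔ0 sub normΔ stabΔ hSDP
  dirG (@generating_interval_exhausting _ _ D hD) hD.
split; last split.
- by case: star => _; exists (image_presentation (OGs_to_OG Γ)
    (star_presentation noeth hΔ0 sub normΔ stabΔ hSDP (cone_exhausting dirG))).
- move=> u hu; have [_ q0 q1] := unit u hu; eexists; exact: conj q0 q1.
- move=> D hD; have [_ q0 q1] := interval D hD; eexists; exact: conj q0 q1.
- by eexists; apply: star.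
- by move=> u hu; eexists; apply: unit.
- by move=> D hD; eexists; apply: interval.
Qed.
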